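(* Let $\Gamma$ be a finitely generated group. Assume that $\Gamma$ has Kazhdan's Property (T), and is either $\mathcal{P}$-stable or $\mathrm{HS}$-stable. Then $\Gamma$ has only finitely many finite-index subgroups.
   Context: Metrics. On $\mathrm{Sym}(n)$ let $d_n^{\mathrm{Hamming}}(\sigma,\tau)=\frac1n|\{x\in\{1,\dots,n\} : \sigma(x)\neq\tau(x)\}|$. On the unitary group $\mathrm{U}(n)$ let $d_n^{\mathrm{HS}}(A,B)=\|A-B\|_{\mathrm{HS}}$, where $\|T\|_{\mathrm{HS}}=\left(\frac1n\mathrm{Tr}(T^*T)\right)^{1/2}$. Put $\mathcal{P}=\{(\mathrm{Sym}(n),d_n^{\mathrm{Hamming}})\}_{n\ge1}$ and $\mathrm{HS}=\{(\mathrm{U}(n),d_n^{\mathrm{HS}})\}_{n\ge1}$. Stability. Let $\mathcal{G}=\{(G_n,d_n)\}_{n\ge1}$ be a family of groups with bi-invariant metrics. Let $\mathbb{F}$ be the free group on a finite set $S$ and $\pi:\mathbb{F}\to\Gamma$ a surjective homomorphism. For a function $f:S\to G$ into a group $G$ and $w\in\mathbb{F}$, $f(w)\in G$ denotes the result of substituting $s\mapsto f(s)$ in $w$. A $\mathcal{G}$-stability-challenge for $\Gamma$ is a sequence of functions $f_k:S\to G_{n_k}$, $n_k\in\mathbb{N}$, such that $d_{n_k}(f_k(w),1)\to0$ as $k\to\infty$ for every $w\in\ker\pi$. A solution for it is a sequence of functions $g_k:S\to G_{n_k}$ such that $g_k(w)=1$ for every $w\in\ker\pi$ and every $k$ (i.e.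 $g_k$ defines a homomorphism $\Gamma\to G_{n_k}$), and $\sum_{s\in S}d_{n_k}(f_k(s),g_k(s))\to0$. The group $\Gamma$ is $\mathcal{G}$-stable if every $\mathcal{G}$-stability-challenge for $\Gamma$ has a solution; this does not depend on the choice of $S$ and $\pi$. Property (T). For $Q\subset\Gamma$, $\kappa>0$ and a unitary representation $(\mathcal{H},\rho)$ of $\Gamma$, a nonzero $v\in\mathcal{H}$ is $(Q,\kappa)$-invariant if $\sup_{x\in Q}\|\rho(x)v-v\|<\kappa\|v\|$. $\Gamma$ has Property (T) if there are a finite $Q\subset\Gamma$ and $\kappa>0$ such that every unitary representation of $\Gamma$ containing a $(Q,\kappa)$-invariant vector contains a nonzero $\Gamma$-invariant vector. *)

(* Defs.v *)
From HB Require Import structures.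
From mathcomp Require Import all_boot all_order all_fingroup all_algebra.
From mathcomp Require Import spectral sesquilinear complex.
From mathcomp Require Import all_classical all_reals all_analysis.
From mathcomp Require Import ring lra.

Set Implicit Arguments.
Unset Strict Implicit.
Unset Printing Implicit Defensive.

Import Order.TTheory GRing.Theory Num.Theory Num.Def.
Import numFieldNormedType.Exports.

Local Open Scope classical_set_scope.
Local Open Scope ring_scope.

Section FreeGroup.
Variable S : finType.

(* Elements are reduced words; [(s, false)] is the letter s and [(s, true)] is
   the letter s^-1. *)
Local Notation letter := (S * bool)%type.

Definition inv_letter (a : letter) : letter := (a.1, ~~ a.2).
Arguments inv_letter : simpl never.

Definition reduced (w : seq letter) : bool :=
  sorted (fun a b => b != inv_letter a) w.

Record free_group := FreeWord { word : seq letter; word_reduced : reduced word }.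

HB.instance Definition _ := [isSub for word].
HB.instance Definition _ := [Choice of free_group by <:].

Definition cons_letter (a : letter) (w : seq letter) : seq letter :=
  if w is b :: w' then if b == inv_letter a then w' else a :: w else [:: a].

Definition mul_word (u v : seq letter) : seq letter := foldr cons_letter v u.

Definition inv_word (u : seq letter) : seq letter := rev (map inv_letter u).

Lemma inv_letterK : involutive inv_letter.
Proof. by case=> s b; rewrite /inv_letter /= negbK. Qed.

Lemma reduced_behead a w : reduced (a :: w) -> reduced w.
Proof. by case: w => //= b w /andP[]. Qed.

Lemma cons_letter_reduced a w : reduced w -> reduced (cons_letter a w).
Proof.
case: w => // b w rw /=; case: ifPn => [_|ba]; first exact: reduced_behead rw.
by rewrite /= ba.
Qed.

Lemma mul_word_reduced u v : reduced v -> reduced (mul_word u v).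
Proof. by move=> rv; elim: u => //= a u; apply: cons_letter_reduced. Qed.

Lemma cons_letterK a w : reduced w ->
  cons_letter a (cons_letter (inv_letter a) w) = w.
Proof.
case: w => [|b w]; first by rewrite /cons_letter eqxx.
rewrite {2}/cons_letter inv_letterK.
case: eqP => [-> |ba] rw; last by rewrite /cons_letter eqxx.
by case: w rw => // c w /= /andP[/negPf -> _].
Qed.

Lemma mul_cons_letter a v w : reduced w ->
  mul_word (cons_letter a v) w = cons_letter a (mul_word v w).
Proof.
case: v => // b v rw /=; case: eqP => // ->.
by rewrite cons_letterK // mul_word_reduced.
Qed.

Lemma mul_wordA u v w : reduced w ->
  mul_word u (mul_word v w) = mul_word (mul_word u v) w.
Proof.
by move=> rw; elim: u => //= a u ->; rewrite mul_cons_letter.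
Qed.

Lemma mul_word0 u : reduced u -> mul_word u [::] = u.
Proof.
elim: u => // a u IHu ru; rewrite /= IHu ?(reduced_behead ru) //.
by case: u ru {IHu} => // b u /= /andP[/negPf -> _].
Qed.

Lemma inv_word_reduced u : reduced u -> reduced (inv_word u).
Proof.
rewrite /reduced /inv_word rev_sorted sorted_map; apply: sub_sorted => a b /=.
by apply: contra => /eqP ->; rewrite inv_letterK.
Qed.

Lemma inv_wordK : involutive inv_word.
Proof. by move=> u; rewrite /inv_word map_rev revK mapK //; apply: inv_letterK. Qed.

Lemma mul_wordV u w : reduced w -> mul_word u (mul_word (inv_word u) w) = w.
Proof.
elim: u w => // a u IHu w rw; rewrite /inv_word /= rev_cons.
rewrite /mul_word foldr_rcons -/(mul_word _ _) -/(mul_word _ _) -/(inv_word u).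
by rewrite IHu ?cons_letterK // cons_letter_reduced.
Qed.

Definition free_one : free_group := @FreeWord [::] isT.
Definition free_mul (u v : free_group) : free_group :=
  FreeWord (mul_word_reduced (word u) (word_reduced v)).
Definition free_inv (u : free_group) : free_group :=
  FreeWord (inv_word_reduced (word_reduced u)).

Lemma free_mulA : associative free_mul.
Proof. by move=> u v w; apply: val_inj; apply: mul_wordA; apply: word_reduced. Qed.
Lemma free_mul1 : left_id free_one free_mul.
Proof. by move=> u; apply: val_inj. Qed.
Lemma free_1mul : right_id free_one free_mul.
Proof. by move=> u; apply: val_inj; apply: mul_word0; apply: word_reduced. Qed.
Lemma free_mulV : right_inverse free_one free_inv free_mul.
Proof.
move=> u; apply: val_inj => /=.
by rewrite -[RHS](@mul_wordV (word u)) // mul_word0 ?inv_word_reduced ?word_reduced.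
Qed.
Lemma free_Vmul : left_inverse free_one free_inv free_mul.
Proof.
move=> u; have uK : free_inv (free_inv u) = u by apply/val_inj/inv_wordK.
by rewrite -{2}uK free_mulV.
Qed.

HB.instance Definition _ := isGroup.Build free_group
  free_mulA free_mul1 free_1mul free_Vmul free_mulV.

Definition free_gen (s : S) : free_group := @FreeWord [:: (s, false)] isT.

End FreeGroup.

Section Subst.
Variables (S : finType) (G : groupType) (f : S -> G).

Definition letter_val (a : S * bool) : G := if a.2 then ((f a.1)^-1)%g else f a.1.

Definition subst (w : free_group S) : G := (\prod_(a <- word w) letter_val a)%g.

Lemma subst_gen s : subst (free_gen s) = f s.
Proof. by rewrite /subst /= big_seq1. Qed.

Lemma letter_valV a : letter_val (inv_letter a) = ((letter_val a)^-1)%g.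
Proof. by case: a => s [] //=; rewrite /letter_val /= invgK. Qed.

Lemma subst_cons a w :
  (\prod_(b <- cons_letter a w) letter_val b
   = letter_val a * \prod_(b <- w) letter_val b)%g.
Proof.
case: w => [|b w] /=; first by rewrite big_seq1 big_nil mulg1.
by case: eqP => [-> |_]; rewrite !big_cons // letter_valV mulKVg.
Qed.

Lemma substM : {morph subst : u v / (u * v)%g}.
Proof.
move=> u v; rewrite /subst /=; elim: (word u) => [|a w IHw] /=.
  by rewrite big_nil mul1g.
by rewrite subst_cons big_cons IHw mulgA.
Qed.

HB.instance Definition _ :=
  isMultiplicative.Build (free_group S) G subst substM.

End Subst.

Section InnerNorm.
Variables (R : realType) (U : lmodType R[i]) (form : {dot U for conjC}).

(* The library forms {dot U for conjC} are linear in the first argument; the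
   norm is taken with values in R rather than in R[i]. *)
Definition inner_norm (u : U) : R := Num.sqrt (complex.Re (form u u)).

Lemma inner_norm_ge0 u : 0 <= inner_norm u.
Proof. exact: sqrtr_ge0. Qed.

Lemma form_Re u : form u u = (complex.Re (form u u))%:C%C.
Proof.
have := dnorm_ge0 form u; rewrite lecE /= => /andP[/eqP im0 _].
by case: (form u u) im0 => a b /= ->.
Qed.

Lemma form_Re_ge0 u : 0 <= complex.Re (form u u).
Proof. by have := dnorm_ge0 form u; rewrite lecE /= => /andP[]. Qed.

Lemma inner_norm_sqr u : inner_norm u ^+ 2 = complex.Re (form u u).
Proof. by rewrite sqr_sqrtr // form_Re_ge0. Qed.

Lemma inner_norm_eq0 u : (inner_norm u == 0) = (u == 0).
Proof.
rewrite -(dnorm_eq0 form) form_Re -sqrf_eq0 inner_norm_sqr.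
by rewrite eq_complex /= eqxx andbT.
Qed.

Lemma inner_norm_sqrD (t : R) u v : inner_norm (u + t%:C%C *: v) ^+ 2 =
  inner_norm u ^+ 2 + t * complex.Re (form u v) *+ 2 + t ^+ 2 * inner_norm v ^+ 2.
Proof.
rewrite !inner_norm_sqr dnormD dnormZ linearZr_LR /= -[in X in _ = X]mulr_natl.
rewrite (form_Re v); case: (form u u) (form u v) => [a b] [c d].
have conjE (z : R[i]) : conjC z = conjc z by [].
rewrite !conjE conjc_real sqr_normc conjc_real; set q := complex.Re (form v v).
change (a + ((t * t - 0 * 0) * q - (t * 0 + 0 * t) * 0)
  + ((t * c - 0 * d) + (t * c - 0 * d)) = a + 2 * (t * c) + t ^+ 2 * q).
ring.
Qed.

Lemma inner_CauchySchwarz u v :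
  complex.Re (form u v) <= inner_norm u * inner_norm v.
Proof.
have [v0|v_neq0] := eqVneq v 0.
  by rewrite v0 linear0r mulr_ge0 ?inner_norm_ge0.
have v_gt0 : 0 < inner_norm v.
  by rewrite lt_def inner_norm_eq0 v_neq0 inner_norm_ge0.
set b := complex.Re _; set x := inner_norm u; set y := inner_norm v in v_gt0 *.
have := sqr_ge0 (inner_norm (u + (- (b / y ^+ 2))%:C%C *: v)).
rewrite inner_norm_sqrD -/b -/x -/y.
have -> : x ^+ 2 + - (b / y ^+ 2) * b *+ 2 + (- (b / y ^+ 2)) ^+ 2 * y ^+ 2
  = x ^+ 2 - b ^+ 2 / y ^+ 2 by field; rewrite gt_eqF.
rewrite subr_ge0 ler_pdivrMr ?exprn_gt0 // -exprMn => le2.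
have xy0 : 0 <= x * y by rewrite mulr_ge0 ?inner_norm_ge0.
by rewrite leNgt; apply/negP => lt_xy; nra.
Qed.

Lemma inner_norm_triangle u v :
  inner_norm (u + v) <= inner_norm u + inner_norm v.
Proof.
have := inner_norm_sqrD 1 u v; rewrite scale1r.
have := inner_CauchySchwarz u v.
have := inner_norm_ge0 u; have := inner_norm_ge0 v; have := inner_norm_ge0 (u + v).
by move=> *; rewrite leNgt; apply/negP => lt_uv; nra.
Qed.

End InnerNorm.

Record hilbertSpace (R : realType) := HilbertSpace {
  hspace :> lmodType R[i];
  inner : {dot hspace for conjC};
  hilbert_complete : forall u : nat -> hspace,
    (forall e : R, 0 < e -> exists N : nat, forall m n : nat,
       (N <= m)%N -> (N <= n)%N -> inner_norm inner (u m - u n) < e) ->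
    exists l : hspace, inner_norm inner (u n - l) @[n --> \oo] --> (0 : R)
}.

Definition hnorm (R : realType) (H : hilbertSpace R) (v : H) : R :=
  inner_norm (inner H) v.

Record unitary_rep (R : realType) (Gamma : groupType) (H : hilbertSpace R) :=
  UnitaryRep {
    rep_act :> Gamma -> {linear H -> H};
    rep_act1 : forall v, rep_act 1%g v = v;
    rep_actM : forall x y v, rep_act (x * y)%g v = rep_act x (rep_act y v);
    rep_inner : forall x u v,
      inner H (rep_act x u) (rep_act x v) = inner H u v
  }.

(* [sup] is 0 on the empty set, so any v <> 0 is almost invariant for an empty Q
   and kappa > 0; the set is always bounded by 2 * hnorm v. *)
Definition almost_invariant (R : realType) (Gamma : groupType)
    (H : hilbertSpace R) (rho : unitary_rep Gamma H)
    (Q : set Gamma) (kappa : R) (v : H) : Prop :=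
  v <> 0 /\ sup [set hnorm (rho x v - v) | x in Q] < kappa * hnorm v.

Definition invariant_vector (R : realType) (Gamma : groupType)
    (H : hilbertSpace R) (rho : unitary_rep Gamma H) (v : H) : Prop :=
  forall x : Gamma, rho x v = v.

Definition property_T (R : realType) (Gamma : groupType) : Prop :=
  exists (Q : set Gamma) (kappa : R), finite_set Q /\ 0 < kappa /\
    forall (H : hilbertSpace R) (rho : unitary_rep Gamma H),
      (exists v : H, almost_invariant rho Q kappa v) ->
      exists v : H, v <> 0 /\ invariant_vector rho v.

Record biinvariant_metric (R : realType) (G : groupType) (d : G -> G -> R) :
    Prop := BiinvariantMetric {
  dist_ge0 : forall x y, 0 <= d x y;
  dist_eq0 : forall x y, d x y = 0 <-> x = y;
  dist_sym : forall x y, d x y = d y x;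
  dist_triangle : forall x y z, d x z <= d x y + d y z;
  dist_mull : forall z x y, d (z * x)%g (z * y)%g = d x y;
  dist_mulr : forall z x y, d (x * z)%g (y * z)%g = d x y
}.

Record metric_family (R : realType) := MetricFamily {
  fam_group :> nat -> groupType;
  fam_dist : forall n, fam_group n -> fam_group n -> R;
  fam_distP : forall n, biinvariant_metric (@fam_dist n)
}.

Definition hamming_dist (R : realType) (n : nat) (s t : {perm 'I_n}) : R :=
  #|[pred x | s x != t x]|%:R / n%:R.

Section Hamming.
Variables (R : realType) (n : nat).
Local Notation d := (@hamming_dist R n.+1).

Lemma hamming_dist_metric : biinvariant_metric d.
Proof.
split.
- by move=> s t; rewrite divr_ge0.
- move=> s t; split=> [/eqP|->]; last first.
    by rewrite /hamming_dist eq_card0 ?mul0r // => x; rewrite !inE eqxx.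
  rewrite mulf_eq0 invr_eq0 !pnatr_eq0 orbF => /eqP/card0_eq st0.
  by apply/permP => x; have := st0 x; rewrite !inE => /negbFE/eqP.
- move=> s t; congr (_%:R / _); apply: eq_card => x; by rewrite !inE eq_sym.
- move=> s t u; rewrite -mulrDl ler_pM2r ?invr_gt0 ?ltr0n // -natrD ler_nat.
  rewrite -cardUI; apply: leq_trans (leq_addr _ _); apply/subset_leq_card/fintype.subsetP.
  move=> x; rewrite !inE -negb_and; apply: contra => /andP[/eqP -> /eqP ->] //.
- move=> z s t; congr (_%:R / _); rewrite -!sum1_card [RHS](reindex_inj (@perm_inj _ z)).
  by apply: eq_bigl => x; rewrite !inE !permM.
- move=> z s t; congr (_%:R / _); apply: eq_card => x.
  by rewrite !inE !permM (inj_eq perm_inj).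
Qed.

End Hamming.

Section UnitaryGroup.
Variables (R : realType) (n : nat).
Local Open Scope sesquilinear_scope.

Record unitary_group := UnitaryMatrix {
  unitary_mx : 'M[R[i]]_n;
  unitary_mxP : unitary_mx \is unitarymx
}.

HB.instance Definition _ := [isSub for unitary_mx].
HB.instance Definition _ := [Choice of unitary_group by <:].

Lemma unitary1 : (1%:M : 'M[R[i]]_n) \is unitarymx.
Proof. by apply/unitarymxP; rewrite trmx1 map_mx1 mulmx1. Qed.

Definition unitary_one : unitary_group := UnitaryMatrix unitary1.
Definition unitary_mul (A B : unitary_group) : unitary_group :=
  UnitaryMatrix (mul_unitarymx (unitary_mxP A) (unitary_mxP B)).
Definition unitary_inv (A : unitary_group) : unitary_group :=
  @UnitaryMatrix ((unitary_mx A)^t*) (etrans (trmxC_unitary _) (unitary_mxP A)).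

Lemma unitary_mulA : associative unitary_mul.
Proof. by move=> A B C; apply: val_inj; apply: mulmxA. Qed.
Lemma unitary_1mul : left_id unitary_one unitary_mul.
Proof. by move=> A; apply: val_inj; apply: mul1mx. Qed.
Lemma unitary_mul1 : right_id unitary_one unitary_mul.
Proof. by move=> A; apply: val_inj; apply: mulmx1. Qed.
Lemma unitary_mulV : right_inverse unitary_one unitary_inv unitary_mul.
Proof. by move=> A; apply: val_inj; apply/unitarymxP/unitary_mxP. Qed.
Lemma unitary_Vmul : left_inverse unitary_one unitary_inv unitary_mul.
Proof.
by move=> A; apply: val_inj; apply: mulmx1C; apply/unitarymxP/unitary_mxP.
Qed.

HB.instance Definition _ := isGroup.Build unitary_group
  unitary_mulA unitary_1mul unitary_mul1 unitary_Vmul unitary_mulV.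

Definition hs_norm (T : 'M[R[i]]_n) : R :=
  Num.sqrt (complex.Re (\tr (T^t* *m T)) / n%:R).

Definition hs_dist (A B : unitary_group) : R :=
  hs_norm (unitary_mx A - unitary_mx B).

Lemma hs_normE (T : 'M[R[i]]_n) :
  hs_norm T = inner_norm (@dotmx R[i] (n * n)) (mxvec T) / Num.sqrt n%:R.
Proof.
suff trE : \tr (T^t* *m T) = @dotmx R[i] (n * n) (mxvec T) (mxvec T).
  by rewrite /hs_norm /inner_norm trE sqrtrM ?sqrtrV ?form_Re_ge0.
rewrite dotmxE mxE (reindex _ (curry_mxvec_bij n n)) /= /mxtrace.
transitivity (\sum_i \sum_j conjC (T j i) * T j i).
  by apply: eq_bigr => i _; rewrite mxE; apply: eq_bigr => j _; rewrite !mxE.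
rewrite exchange_big pair_big /=; apply: eq_bigr => -[i j] _ /=.
by rewrite mxvecE [in RHS]mxE [in RHS]mxE mxvecE mulrC.
Qed.

Lemma hs_norm_ge0 T : 0 <= hs_norm T.
Proof. exact: sqrtr_ge0. Qed.

Lemma hs_norm_eq0 T : (0 < n)%N -> (hs_norm T == 0) = (T == 0).
Proof.
move=> n0; rewrite hs_normE mulf_eq0 inner_norm_eq0 invr_eq0 sqrtr_eq0.
by rewrite lern0 eqn0Ngt n0 orbF mxvec_eq0.
Qed.

Lemma hs_normD T1 T2 : hs_norm (T1 + T2) <= hs_norm T1 + hs_norm T2.
Proof.
rewrite !hs_normE linearD -mulrDl ler_wpM2r ?invr_ge0 ?sqrtr_ge0 //.
exact: inner_norm_triangle.
Qed.

Lemma hs_normN T : hs_norm (- T) = hs_norm T.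
Proof. by rewrite /hs_norm [(- T)^T]linearN /= map_mxN mulNmx mulmxN opprK. Qed.

Lemma hs_norm_mull U T : U \is unitarymx -> hs_norm (U *m T) = hs_norm T.
Proof.
move=> /unitarymxP/mulmx1C UU; rewrite /hs_norm trmx_mul map_mxM mulmxA.
by rewrite -(mulmxA _ _ U) UU mulmx1.
Qed.

Lemma hs_norm_mulr U T : U \is unitarymx -> hs_norm (T *m U) = hs_norm T.
Proof.
move=> /unitarymxP UU; rewrite /hs_norm trmx_mul map_mxM -mulmxA mxtrace_mulC.
by rewrite -!mulmxA UU mulmx1.
Qed.

Lemma hs_dist_metric : (0 < n)%N -> biinvariant_metric hs_dist.
Proof.
move=> n0; rewrite /hs_dist; split.
- by move=> A B; apply: hs_norm_ge0.
- move=> A B; split=> [/eqP|->]; last by apply/eqP; rewrite hs_norm_eq0 // subrr.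
  by rewrite hs_norm_eq0 // subr_eq0 => /eqP/val_inj.
- by move=> A B; rewrite -hs_normN opprB.
- move=> A B C.
  by rewrite -[X in hs_norm X <= _](subrKA (unitary_mx B)) hs_normD.
- by move=> A B C; rewrite /= -mulmxBr hs_norm_mull // unitary_mxP.
- by move=> A B C; rewrite /= -mulmxBl hs_norm_mulr // unitary_mxP.
Qed.

End UnitaryGroup.

(* The index n stands for degree n.+1, so that the families range over n >= 1.
   The product of {perm T} is (s * t) x = t (s x); inversion is an isometric
   isomorphism onto the opposite convention. *)
Definition sym_family (R : realType) : metric_family R :=
  @MetricFamily R (fun n => {perm 'I_n.+1}) (fun n => @hamming_dist R n.+1)
    (fun n => @hamming_dist_metric R n).

Definition unitary_family (R : realType) : metric_family R :=
  @MetricFamily R (fun n => unitary_group R n.+1) (fun n => @hs_dist R n.+1)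
    (fun n => @hs_dist_metric R n.+1 isT).

Section Stability.
Variables (R : realType) (G : metric_family R).
Variables (Gamma : groupType) (S : finType).
Variable pi : {multiplicative free_group S -> Gamma}.

Definition stability_challenge (n : nat -> nat)
    (f : forall k : nat, S -> G (n k)) : Prop :=
  forall w : free_group S, pi w = 1%g ->
    fam_dist (subst (f k) w) 1%g @[k --> \oo] --> (0 : R).

Definition stability_solution (n : nat -> nat)
    (f g : forall k : nat, S -> G (n k)) : Prop :=
  (forall (k : nat) (w : free_group S), pi w = 1%g -> subst (g k) w = 1%g) /\
  (\sum_(s : S) fam_dist (f k s) (g k s)) @[k --> \oo] --> (0 : R).

Definition stable_wrt : Prop :=
  forall (n : nat -> nat) (f : forall k : nat, S -> G (n k)),
    stability_challenge f -> exists g, stability_solution f g.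

End Stability.

Definition surjective_hom (Gamma : groupType) (S : finType)
    (pi : {multiplicative free_group S -> Gamma}) : Prop :=
  forall x : Gamma, exists w, pi w = x.

Definition finitely_generated (Gamma : groupType) : Prop :=
  exists (S : finType) (pi : {multiplicative free_group S -> Gamma}),
    surjective_hom pi.

(* [stable_wrt G pi] does not depend on the choice of [S] and [pi], so for a
   finitely generated group asking for some or for all [pi] is the same. *)
Definition stable (R : realType) (G : metric_family R) (Gamma : groupType) :
    Prop :=
  exists (S : finType) (pi : {multiplicative free_group S -> Gamma}),
    surjective_hom pi /\ stable_wrt G pi.

Definition is_subgroup (Gamma : groupType) (H : set Gamma) : Prop :=
  group_closed (mem H).

Definition left_coset (Gamma : groupType) (H : set Gamma) (x : Gamma) :
    set Gamma := [set (x * h)%g | h in H].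

Definition finite_index (Gamma : groupType) (H : set Gamma) : Prop :=
  finite_set (range (left_coset H)).

(* Main.v *)
From HB Require Import structures.
Require Import Defs.
From mathcomp Require Import all_boot all_order all_fingroup all_algebra.
From mathcomp Require Import spectral sesquilinear complex.
From mathcomp Require Import all_classical all_reals all_analysis.
From mathcomp Require Import finmap zify ring lra.

(** Suppose that [Gamma] has infinitely many subgroups of finite index. Such a
    subgroup is a point stabilizer of a transitive action on a finite set, and a
    finitely generated group has finitely many actions on a given finite set, so
    [Gamma] acts transitively on arbitrarily large finite sets
    ([large_transitive_action]). Either kind of stability contradicts this.

    The engine is [stable_shrink]. In both families the n-th group embeds in the
    next one, by fixing one more point or one more coordinate. The embedding
    distorts distances by a factor at most 2, and every element of the next group
    is at distance o(1) from the image. Moving the values on the generators of a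
    homomorphism from [Gamma] to the (n+1)-st group to nearby elements of the image
    gives a stability challenge in the n-th groups. A solution consists of
    homomorphisms [psi] to the n-th groups which, on a given finite subset of
    [Gamma], are as close as desired to the given homomorphisms [phi] to the
    (n+1)-st groups. Hence the inclusion [T] of the smaller vector space in the
    larger one, a matrix with n rows acting on row vectors, is almost invariant under
    the unitary representation of [Gamma] on matrices by
    [T |-> psi(x)^* T phi(x)], and Property (T) applies.

    In the unitary case let [phi] be irreducible. A nonzero invariant matrix is an
    intertwiner, and by Schur's lemma its rank is the dimension of [phi], although it
    has one row less ([unitary_stable_bounded]). This needs irreducible
    representations of unbounded dimension ([large_irreducible]). By Property (T),
    irreducible representations that are close to each other are intertwined;
    since unitary groups are totally bounded, irreducible representations of bounded
    dimension have finitely many kernels. If all irreducible representations with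
    finite image had bounded dimension, then the permutation representations, which
    split into such representations, would all factor through one finite quotient of
    [Gamma], and the transitive actions would have bounded size.

    In the permutation case let [phi] be transitive. Here invariant matrices always
    exist, for instance the constant ones. But Property (T) in the complement of the
    invariant matrices shows that [T] is close to its average over [Gamma]
    ([kazhdan_projection]). The stabilizer of a point of the smaller set moves every
    point of the larger set, because otherwise a set would inject into a smaller one
    ([stabilizer_moves]). It follows that the average has entries at most 1/2 where
    [T] has entries 1, so [T] is far from its average ([corner_defect_ge]). *)

Set Implicit Arguments.
Unset Strict Implicit.
Unset Printing Implicit Defensive.

Import Order.TTheory GRing.Theory Num.Theory Num.Def.
Import numFieldNormedType.Exports.

Local Open Scope classical_set_scope.
Local Open Scope ring_scope.
Local Open Scope sesquilinear_scope.

(** * Group homomorphisms and word maps *)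

Definition hom_of (G H : groupType) (f : G -> H)
    (fM : {morph f : x y / (x * y)%g}) : {multiplicative G -> H} :=
  HB.pack f (isMultiplicative.Build G H f fM).

Section GroupHom.
Variables (G H : groupType) (h : {multiplicative G -> H}).

Lemma hom1 : h 1%g = 1%g.
Proof. by apply: (mulgI (h 1%g)); rewrite -gmulfM !mulg1. Qed.

Lemma homV x : h x^-1%g = (h x)^-1%g.
Proof. by apply: (mulgI (h x)); rewrite -gmulfM !mulgV hom1. Qed.

Lemma homF x y : h (x * y^-1)%g = (h x * (h y)^-1)%g.
Proof. by rewrite gmulfM homV. Qed.

End GroupHom.

Section Words.
Variable S : finType.

Lemma subst_hom (G H : groupType) (h : {multiplicative G -> H}) (f : S -> G) w :
  subst (h \o f) w = h (subst f w).
Proof.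
rewrite /subst (big_morph h gmulfM (hom1 h)); apply: eq_bigr => -[s b] _.
by rewrite /letter_val /=; case: b; rewrite ?homV.
Qed.

Lemma subst_multiplicative (G : groupType) (h : {multiplicative free_group S -> G}) w :
  subst (h \o @free_gen S) w = h w.
Proof.
rewrite subst_hom; congr (h _); apply: val_inj; rewrite /subst /=.
case: w => /=; elim=> [|a w IHw] rw; first by rewrite big_nil.
have rw' := reduced_behead rw.
rewrite big_cons /= IHw //.
have -> : word (letter_val (@free_gen S) a) = [:: a] by case: a {rw} => s [].
by case: w rw {IHw rw'} => //= b w /andP[/negPf ->].
Qed.

Lemma subst_gens (G Gamma : groupType) (pi : {multiplicative free_group S -> Gamma})
    (phi : {multiplicative Gamma -> G}) w :
  subst (fun s => phi (pi (free_gen s))) w = phi (pi w).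
Proof. exact: (@subst_multiplicative G (phi \o pi : {multiplicative _ -> _}) w). Qed.

(** The universal property of the presentation: an assignment of the generators
    that kills the relations factors through [Gamma]. *)
Lemma hom_of_relations (Gamma G : groupType)
    (pi : {multiplicative free_group S -> Gamma}) (f : S -> G) :
  surjective_hom pi -> (forall w, pi w = 1%g -> subst f w = 1%g) ->
  exists psi : {multiplicative Gamma -> G}, forall w, psi (pi w) = subst f w.
Proof.
move=> /choice[lift liftK] fP.
have f_eq u v : pi u = pi v -> subst f u = subst f v.
  move=> uv; apply/divg1_eq; rewrite -homF; apply: fP.
  by rewrite homF uv divgg.
pose psi x := subst f (lift x).
have psiM : {morph psi : x y / (x * y)%g}.
  by move=> x y; rewrite /psi -gmulfM; apply: f_eq; rewrite gmulfM !liftK.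
by exists (hom_of psiM) => w; apply: f_eq; rewrite liftK.
Qed.

Section Distance.
Variables (R : realType) (G : groupType) (d : G -> G -> R).
Hypothesis dP : biinvariant_metric d.

Lemma dist_mul x y x' y' : d (x * y)%g (x' * y')%g <= d x x' + d y y'.
Proof.
apply: le_trans (dist_triangle dP _ (x' * y)%g _) _.
by rewrite (dist_mulr dP) (dist_mull dP).
Qed.

Lemma dist_inv x y : d x^-1%g y^-1%g = d x y.
Proof.
rewrite -(dist_mull dP x) mulgV -(dist_mulr dP y) mul1g.
by rewrite -mulgA mulVg mulg1 (dist_sym dP).
Qed.

(** Bi-invariance makes word maps Lipschitz, with constant the word length. *)
Lemma subst_dist (f g : S -> G) w :
  d (subst f w) (subst g w) <= (size (word w))%:R * \sum_s d (f s) (g s).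
Proof.
rewrite /subst; elim: (word w) => [|[s b] w' IHw].
  by rewrite !big_nil (proj2 (dist_eq0 dP _ _)) // mul0r.
rewrite !big_cons; apply: le_trans (dist_mul _ _ _ _) _.
rewrite /= -natr1 mulrDl mul1r addrC lerD //.
have -> : d (letter_val f (s, b)) (letter_val g (s, b)) = d (f s) (g s).
  by rewrite /letter_val /=; case: b; rewrite ?dist_inv.
by rewrite (bigD1 s) //= lerDl sumr_ge0 // => i _; apply: dist_ge0.
Qed.

End Distance.
End Words.

(** * Stability and homomorphisms to the next smaller group *)

Section Shrink.
Variables (R : realType) (G : metric_family R).
Variable iota : forall n, {multiplicative G n -> G n.+1}.
Variable c : nat -> R.
Hypothesis iota_expand : forall n a b,
  fam_dist a b <= 2 * fam_dist (@iota n a) (iota n b).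
Hypothesis iota_contract : forall n a b,
  fam_dist (@iota n a) (iota n b) <= fam_dist a b.
Hypothesis iota_dense : forall n x, exists a, fam_dist (@iota n a) x <= c n.
Hypothesis c_cvg : c n @[n --> \oo] --> (0 : R).

Variables (Gamma : groupType) (S : finType).
Variable pi : {multiplicative free_group S -> Gamma}.
Hypotheses (pi_surj : surjective_hom pi) (pi_stable : stable_wrt G pi).

(** Homomorphisms to the larger groups that satisfy [P], for unboundedly many [n],
    can be approximated on [Q] by homomorphisms to the smaller groups: pull the
    values on the generators back to the smaller groups, then correct the result by
    stability. *)
Lemma stable_shrink (P : forall n, {multiplicative Gamma -> G n.+1} -> Prop) :
  (forall d, exists n (phi : {multiplicative Gamma -> G n.+1}), (d <= n)%N /\ P n phi) ->
  forall (Q : set Gamma) (e : R), finite_set Q -> 0 < e ->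
  exists n (phi : {multiplicative Gamma -> G n.+1})
    (psi : {multiplicative Gamma -> G n}),
    P n phi /\ forall x, Q x -> fam_dist (iota n (psi x)) (phi x) < e.
Proof.
move=> unbounded Q e Qfin e0.
have [n /(_ _)/cid-/all_tag[phi phiP]] := choice unbounded.
have n_ge k := (phiP k).1; have P_phi k := (phiP k).2.
have cn_cvg : c (n k) @[k --> \oo] --> (0 : R).
  apply: cvg_comp c_cvg => A [N _ NA].
  exists N => // k /= Nk; apply: NA; exact: leq_trans Nk (n_ge k).
have /(_ _)/cid-/all_tag[f fP] k : exists f : S -> G (n k),
    forall s, fam_dist (iota (n k) (f s)) (phi k (pi (free_gen s))) <= c (n k).
  by have /choice[f fP] := fun s => iota_dense (phi k (pi (free_gen s))); exists f.
have bigc k (F : S -> R) : (forall s, F s <= c (n k)) ->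
    \sum_s F s <= #|S|%:R * c (n k).
  move=> le; apply: le_trans (ler_sum _ (fun i _ => le i)) _.
  by rewrite sumr_const mulr_natl.
have f_chal : stability_challenge pi f.
  move=> w w1.
  apply: (@squeeze_cvgr _ _ _ _ (fun=> 0)
    (fun k => 2 * ((size (word w))%:R * (#|S|%:R * c (n k))))); last 2 first.
  - exact: cvg_cst.
  - rewrite -[X in _ --> X](mulr0 2); apply: cvgM; first exact: cvg_cst.
    rewrite -[X in _ --> X](mulr0 (size (word w))%:R); apply: cvgM; first exact: cvg_cst.
    by rewrite -[X in _ --> X](mulr0 #|S|%:R); apply: cvgM => //; exact: cvg_cst.
  apply: nearW => k; rewrite (dist_ge0 (fam_distP G _)) /=.
  apply: le_trans (iota_expand _ _) _; rewrite ler_pM2l //.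
  rewrite hom1 -subst_hom.
  have <- : subst (fun s => phi k (pi (free_gen s))) w = 1%g.
    by rewrite subst_gens w1 hom1.
  apply: le_trans (subst_dist (fam_distP G _) _ _ _) _.
  by rewrite ler_wpM2l //; apply: bigc => s; exact: fP.
have [g [g_rel g_cvg]] := pi_stable f_chal.
have /choice[wd wdP] := pi_surj.
pose L := \sum_(x \in Q) ((size (word (wd x)))%:R : R).
pose B k : R := #|S|%:R * c (n k) + \sum_s fam_dist (f k s) (g k s).
have B_cvg : (L * B k) @[k --> \oo] --> (0 : R).
  rewrite -[X in _ --> X](mulr0 L); apply: cvgM; first exact: cvg_cst.
  rewrite -[X in _ --> X](addr0 0); apply: cvgD => //.
  by rewrite -[X in _ --> X](mulr0 #|S|%:R); apply: cvgM => //; exact: cvg_cst.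
have [k kP] : exists k, L * B k < e.
  have /cvgrPdist_lt/(_ e e0)[N _ NP] := B_cvg.
  exists N; have := NP N (leqnn N); rewrite /= sub0r normrN.
  by apply: le_lt_trans; rewrite ler_norm.
(* L bounds the lengths of words for the elements of Q, and B k the displacement of
   the generators *)
have [psi psiP] := hom_of_relations pi_surj (g_rel k).
exists (n k), (phi k), psi; split => // x Qx.
apply: le_lt_trans kP; rewrite -{1 2}(wdP x) psiP -subst_hom.
rewrite -[phi k _]subst_gens.
apply: le_trans (subst_dist (fam_distP G _) _ _ _) _.
have d0 := dist_ge0 (fam_distP G _).
apply: ler_pM => //; first by apply: sumr_ge0 => s _; exact: d0.
  rewrite /L (fsbigD1 x) //= lerDl.
  by rewrite fsbig_finite /=; [apply: sumr_ge0|exact: finite_setD].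
apply: (@le_trans _ _ (\sum_s (fam_dist (iota (n k) (f k s)) (phi k (pi (free_gen s)))
    + fam_dist (f k s) (g k s)))).
  apply: ler_sum => s _.
  rewrite addrC; apply: le_trans (dist_triangle (fam_distP G _) _ (iota (n k) (f k s)) _) _.
  by rewrite lerD2r (dist_sym (fam_distP G _)) iota_contract.
by rewrite big_split lerD2r; apply: bigc => s; exact: fP.
Qed.

End Shrink.

(** * Subgroups of finite index and transitive actions *)

Section Actions.
Variable Gamma : groupType.

Definition transitive_action n (phi : Gamma -> {perm 'I_n}) :=
  forall i j, exists x, phi x i = j.

Lemma finite_index_code (H : set Gamma) : is_subgroup H -> finite_index H ->
  exists n (c : Gamma -> 'I_n), (forall i, exists x, c x = i) /\
    forall x y, c x = c y <-> H (x^-1 * y)%g.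
Proof.
move=> [H1 HV] /finite_fsetP[F FE].
have inF x : left_coset H x \in F.
  have : range (left_coset H) (left_coset H x) by exists x.
  by rewrite FE.
pose c x : 'I_#|{: F}| := enum_rank [` inF x]%fset.
exists #|{: F}|, c; split=> [i|x y].
  have : range (left_coset H) (val (enum_val i)) by rewrite FE; exact: valP.
  case=> x _ xE; exists x; rewrite /c -[RHS]enum_valK; congr enum_rank.
  exact: val_inj.
have in1 : H 1%g by exact: set_mem H1.
have inF' u v : H u -> H v -> H (u * v^-1)%g.
  by move=> /mem_set Hu /mem_set Hv; apply: set_mem; apply: HV.
have inV u : H u -> H u^-1%g by move=> Hu; rewrite -[u^-1%g]mul1g; apply: inF'.
have inM u v : H u -> H v -> H (u * v)%g.
  by move=> Hu /inV Hv; rewrite -[v]invgK; apply: inF'.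
split=> [/enum_rank_inj/(congr1 val)/= xy|Hxy].
  have : left_coset H y y by exists 1%g => //; rewrite mulg1.
  by rewrite -xy => -[h Hh <-]; rewrite mulKg.
congr enum_rank; apply: val_inj => /=; apply/seteqP; split=> z [h Hh <-].
  exists (y^-1 * (x * h))%g; last by rewrite mulVKg.
  have -> : (y^-1 * (x * h) = (x^-1 * y)^-1 * h)%g by rewrite invgM invgK mulgA.
  by apply: inM => //; exact: inV.
by exists (x^-1 * y * h)%g; [exact: inM|rewrite -!mulgA mulVKg].
Qed.

Lemma coset_action (H : set Gamma) : is_subgroup H -> finite_index H ->
  exists n (phi : {multiplicative Gamma -> {perm 'I_n}}) (p : 'I_n),
    transitive_action phi /\ H = [set x | phi x p = p].
Proof.
move=> sH /(finite_index_code sH)[n [c [c_surj cE]]].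
have [r rK] := choice c_surj.
have c_mul x u v : c u = c v -> c (x * u)%g = c (x * v)%g.
  by move=> /cE Huv; apply/cE; rewrite invgM -mulgA mulKg.
(* A product of permutations applies its left factor first, so left translation of
   the cosets needs an inverse *)
pose a x i := c (x^-1 * r i)%g.
have aE x u : a x (c u) = c (x^-1 * u)%g by apply: c_mul; rewrite rK.
have aK x : cancel (a x) (a x^-1%g).
  by move=> i; rewrite -(rK i) !aE invgK mulVKg.
pose phi x := perm (can_inj (aK x)).
have phiM : {morph phi : x y / (x * y)%g}.
  move=> x y; apply/permP => i.
  by rewrite permM !permE -(rK i) !aE invgM mulgA.
exists n, (hom_of phiM), (c 1%g); split=> [i j|].
  exists (r i * (r j)^-1)%g; rewrite /= permE /a.
  by rewrite invgM invgK mulgVK rK.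
apply/funext => x; apply/propext; rewrite /= permE aE mulg1.
by rewrite cE invgK mulg1.
Qed.

End Actions.

Section FewSubgroups.
Variables (Gamma : groupType) (S : finType).
Variable pi : {multiplicative free_group S -> Gamma}.
Hypothesis pi_surj : surjective_hom pi.

(** A subgroup of index [n] is a point stabilizer of an action on [n] points, and
    such an action is determined by the permutations of the generators. *)
Lemma finite_stabilizers n :
  finite_set [set H : set Gamma | exists (phi : {multiplicative Gamma -> {perm 'I_n}}) p,
    H = [set x | phi x p = p]].
Proof.
pose stab (fp : {ffun S -> {perm 'I_n}} * 'I_n) : set Gamma :=
  [set x | exists2 w, pi w = x & subst fp.1 w fp.2 = fp.2].
apply: (@sub_finite_set _ _ (range stab)); last by apply: finite_image; exact: finite_finset.
move=> H [phi [p ->]]; exists ([ffun s => phi (pi (free_gen s))], p) => //.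
have sE w : subst [ffun s => phi (pi (free_gen s))] w = phi (pi w).
  rewrite -subst_gens; apply: eq_bigr => -[s b] _.
  by rewrite /letter_val /= ffunE.
apply/seteqP; split=> x /=.
  by case=> w <-; rewrite sE.
by have [w <-] := pi_surj x; move=> xp; exists w; rewrite ?sE.
Qed.

Lemma large_transitive_action :
  infinite_set [set H : set Gamma | is_subgroup H /\ finite_index H] ->
  forall d, exists n (phi : {multiplicative Gamma -> {perm 'I_n}}),
    (d <= n)%N /\ transitive_action phi.
Proof.
move=> inf d; apply: contrapT => small; apply: inf.
pose stabs n := [set H : set Gamma |
  exists (phi : {multiplicative Gamma -> {perm 'I_n}}) p, H = [set x | phi x p = p]].
apply: (@sub_finite_set _ _ (\bigcup_(n in `I_d) stabs n)); last first.
  by apply: bigcup_finite => [|n _]; [exact: finite_II|exact: finite_stabilizers].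
move=> H [sH fH]; have [n [phi [p [tr HE]]]] := coset_action sH fH.
exists n; last by exists phi, p.
by rewrite /= ltnNge; apply/negP => dn; apply: small; exists n, phi.
Qed.

End FewSubgroups.

(** * The Frobenius norm *)

Section Frobenius.
Variable R : realType.
Local Notation C := R[i].
Local Notation Re := (@complex.Re R).
Local Notation Im := (@complex.Im R).

Lemma ReD (x y : C) : Re (x + y) = Re x + Re y.
Proof. by case: x y => [a b] [c d]. Qed.

Lemma ImD (x y : C) : Im (x + y) = Im x + Im y.
Proof. by case: x y => [a b] [c d]. Qed.

Lemma ReN (x : C) : Re (- x) = - Re x.
Proof. by case: x. Qed.

Lemma ImN (x : C) : Im (- x) = - Im x.
Proof. by case: x. Qed.

Lemma Re_sum I (r : seq I) (P : pred I) (F : I -> C) :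
  Re (\sum_(i <- r | P i) F i) = \sum_(i <- r | P i) Re (F i).
Proof. exact: (big_morph Re ReD). Qed.

Definition sqmod (z : C) : R := Re z ^+ 2 + Im z ^+ 2.

Lemma sqmod_ge0 z : 0 <= sqmod z.
Proof. by rewrite addr_ge0 ?sqr_ge0. Qed.

Lemma Re_mul_conj z : Re (z * conjC z) = sqmod z.
Proof.
case: z => a b; have -> : conjC (a +i* b)%C = (a -i* b)%C by [].
by rewrite /sqmod /=; ring.
Qed.

Lemma dot_mxvec m n (A B : 'M[C]_(m, n)) :
  dotmx (mxvec A) (mxvec B) = \tr (A *m B^t*).
Proof.
rewrite dotmxE mxE (reindex _ (curry_mxvec_bij m n)) /= /mxtrace.
transitivity (\sum_i \sum_j A i j * conjC (B i j)).
  rewrite pair_big /=; apply: eq_bigr => -[i j] _ /=.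
  by rewrite [in LHS]mxE [in LHS]mxE !mxvecE.
by apply: eq_bigr => i _; rewrite mxE; apply: eq_bigr => j _; rewrite !mxE.
Qed.

Lemma dot_tr n (u v : 'rV[C]_n) : dotmx u v = \tr (u *m v^t*).
Proof. by rewrite dotmxE trace_mx11. Qed.

(** The norm is taken in [R] and through [mxvec], so that it is by definition the norm of a row
    vector in the Hilbert spaces below. *)
Definition frob m n (A : 'M[C]_(m, n)) : R := inner_norm (@dotmx C (m * n)) (mxvec A).

Lemma frob_ge0 m n (A : 'M[C]_(m, n)) : 0 <= frob A.
Proof. exact: inner_norm_ge0. Qed.

Lemma frob_sqr m n (A : 'M[C]_(m, n)) : frob A ^+ 2 = Re (\tr (A *m A^t*)).
Proof. by rewrite /frob inner_norm_sqr; exact: (congr1 Re (dot_mxvec A A)). Qed.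

Lemma frob_row n (v : 'rV[C]_n) : inner_norm (@dotmx C n) v = frob v.
Proof.
apply/eqP; rewrite -(eqrXn2 (n := 2)) ?inner_norm_ge0 //.
by rewrite frob_sqr inner_norm_sqr; apply/eqP; exact: (congr1 Re (dot_tr v v)).
Qed.

Lemma frob_mxvec m n (A : 'M[C]_(m, n)) : frob (mxvec A) = frob A.
Proof. by rewrite -frob_row. Qed.

Lemma frob_sqrE m n (A : 'M[C]_(m, n)) :
  frob A ^+ 2 = \sum_i \sum_j sqmod (A i j).
Proof.
rewrite frob_sqr /mxtrace Re_sum; apply: eq_bigr => i _.
rewrite mxE Re_sum; apply: eq_bigr => j _.
by rewrite !mxE Re_mul_conj.
Qed.

Lemma frob_eq0 m n (A : 'M[C]_(m, n)) : (frob A == 0) = (A == 0).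
Proof. by rewrite inner_norm_eq0 mxvec_eq0. Qed.

Lemma eq_frob m n p q (A : 'M[C]_(m, n)) (B : 'M[C]_(p, q)) :
  \tr (A *m A^t*) = \tr (B *m B^t*) -> frob A = frob B.
Proof.
by move=> AB; apply/eqP; rewrite -(eqrXn2 (n := 2)) ?frob_ge0 // !frob_sqr AB.
Qed.

Lemma frobN m n (A : 'M[C]_(m, n)) : frob (- A) = frob A.
Proof. by apply: eq_frob; rewrite [(- A)^T]linearN /= map_mxN mulNmx mulmxN opprK. Qed.

Lemma frobB m n (A B : 'M[C]_(m, n)) : frob (A - B) = frob (B - A).
Proof. by rewrite -frobN opprB. Qed.

Lemma trmxC_mul m n p (A : 'M[C]_(m, n)) (B : 'M[C]_(n, p)) : (A *m B)^t* = B^t* *m A^t*.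
Proof. by rewrite trmx_mul map_mxM. Qed.

Lemma frob_mulr m n p (A : 'M[C]_(m, n)) (U : 'M[C]_(n, p)) :
  U \is unitarymx -> frob (A *m U) = frob A.
Proof.
by move=> /unitarymxP UU; apply: eq_frob; rewrite trmxC_mul mulmxA -(mulmxA A) UU mulmx1.
Qed.

Lemma frob_mull m n (U : 'M[C]_m) (A : 'M[C]_(m, n)) :
  U \is unitarymx -> frob (U *m A) = frob A.
Proof.
move=> /unitarymxP/mulmx1C UU; apply: eq_frob; rewrite trmxC_mul.
by rewrite mxtrace_mulC -mulmxA (mulmxA _ U) UU mul1mx mxtrace_mulC.
Qed.

Lemma frob_hs_norm n (A : 'M[C]_n) : hs_norm A = frob A / Num.sqrt n%:R.
Proof. exact: hs_normE. Qed.

End Frobenius.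

(** * Row vectors as a Hilbert space *)

Section RowHilbert.
Variables (R : realType) (n : nat).
Local Notation C := R[i].
Local Notation Re := (@complex.Re R).
Local Notation Im := (@complex.Im R).

Lemma sqmod_le_frob (v : 'rV[C]_n) j : sqmod (v 0 j) <= frob v ^+ 2.
Proof.
rewrite frob_sqrE big_ord1 (bigD1 j) //= lerDl sumr_ge0 // => i _.
exact: sqmod_ge0.
Qed.

Lemma cvg_sum0 I (r : seq I) (f : I -> nat -> R) :
  (forall i, f i k @[k --> \oo] --> (0 : R)) ->
  \sum_(i <- r) f i k @[k --> \oo] --> (0 : R).
Proof.
move=> f0; elim: r => [|i r IHr].
  under eq_fun => k do rewrite big_nil.
  exact: cvg_cst.
under eq_fun => k do rewrite big_cons.
by have := cvgD (f0 i) IHr; rewrite addr0; apply.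
Qed.

Lemma row_complete (u : nat -> 'rV[C]_n) :
  (forall e : R, 0 < e -> exists N : nat, forall k l : nat,
     (N <= k)%N -> (N <= l)%N -> inner_norm (@dotmx C n) (u k - u l) < e) ->
  exists l : 'rV[C]_n, inner_norm (@dotmx C n) (u k - l) @[k --> \oo] --> (0 : R).
Proof.
move=> u_cauchy.
(* phi stands for the real or the imaginary part *)
have coord (phi : C -> R) : (forall x y, phi (x - y) = phi x - phi y) ->
    (forall z, phi z ^+ 2 <= sqmod z) ->
    forall j, cvgn (fun k => phi (u k 0 j)).
  move=> phiB phi_le j; apply/cauchy_cvgP/cauchy_exP => e e0.
  have [N NP] := u_cauchy e e0; exists (phi (u N 0 j)), N => // k /= Nk.
  rewrite -ball_normE /ball_ /= -phiB -ltr_sqr ?nnegrE ?normr_ge0 ?(ltW e0) //.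
  rewrite real_normK ?num_real //.
  apply: le_lt_trans (phi_le _) _.
  have -> : u N 0 j - u k 0 j = (u N - u k) 0 j by rewrite !mxE.
  apply: le_lt_trans (sqmod_le_frob _ _) _.
  by rewrite ltr_sqr ?nnegrE ?frob_ge0 ?ltW // -frob_row NP.
have reC := coord Re (fun x y => etrans (ReD _ _) (congr1 _ (ReN y)))
  (fun z => etrans (lerDl _ _) (sqr_ge0 _)).
have imC := coord Im (fun x y => etrans (ImD _ _) (congr1 _ (ImN y)))
  (fun z => etrans (lerDr _ _) (sqr_ge0 _)).
pose l : 'rV[C]_n := \row_j (limn (fun k => Re (u k 0 j)) +i* limn (fun k => Im (u k 0 j)))%C.
exists l.
have sq_cvg (a : nat -> R) : cvgn a -> (a k - limn a) ^+ 2 @[k --> \oo] --> (0 : R).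
  move=> ca; rewrite -[X in _ --> X](mulr0 0) -(subrr (limn a)).
  by apply: cvgM; apply: cvgB => //; exact: cvg_cst.
have : frob (u k - l) ^+ 2 @[k --> \oo] --> (0 : R).
  under eq_fun => k do rewrite frob_sqrE big_ord1.
  apply: cvg_sum0 => j; under eq_fun => k.
    rewrite !mxE /sqmod ReD ReN ImD ImN /=; over.
  by have := cvgD (sq_cvg _ (reC j)) (sq_cvg _ (imC j)); rewrite addr0; apply.
move=> sq0; have := cvg_comp _ _ sq0 (@sqrt_continuous R 0); rewrite sqrtr0.
suff -> : (fun k => inner_norm (@dotmx C n) (u k - l)) =
    Num.sqrt \o (fun k => frob (u k - l) ^+ 2) by [].
by apply/funext => k /=; rewrite sqrtr_sqr ger0_norm ?frob_ge0 // frob_row.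
Qed.

Definition row_hilbert : hilbertSpace R := HilbertSpace row_complete.

End RowHilbert.

(** * Property (T) for matrix representations *)

Section UnitaryMatrices.
Variables (R : realType) (n : nat).

Lemma unitary_mxM (a b : unitary_group R n) :
  unitary_mx (a * b)%g = unitary_mx a *m unitary_mx b.
Proof. by []. Qed.

Lemma unitary_mx1 : unitary_mx (1%g : unitary_group R n) = 1%:M.
Proof. by []. Qed.

Lemma unitary_mxV (a : unitary_group R n) : unitary_mx a^-1%g = (unitary_mx a)^t*.
Proof. by []. Qed.

Lemma unitary_mxK (a : unitary_group R n) m (A : 'M[R[i]]_(m, n)) :
  A *m unitary_mx a *m (unitary_mx a)^t* = A.
Proof. by rewrite mulmxtVK // unitary_mxP. Qed.

Lemma unitary_mxKV (a : unitary_group R n) m (A : 'M[R[i]]_(m, n)) :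
  A *m (unitary_mx a)^t* *m unitary_mx a = A.
Proof. by rewrite mulmxKtV // unitary_mxP. Qed.

End UnitaryMatrices.

Section MatrixPropertyT.
Variables (R : realType) (Gamma : groupType).
Local Notation C := R[i].

(** Property (T) as it is used below: only for the representations by unitary matrices, and with a
    non-strict bound at each element of [Q] instead of a strict one for the supremum. *)
Definition kazhdan_pair (Q : set Gamma) (kappa : R) :=
  forall n (rho : {multiplicative Gamma -> unitary_group R n}) (v : 'rV[C]_n),
    v != 0 ->
    (forall x, Q x -> frob (v *m unitary_mx (rho x) - v) <= kappa * frob v) ->
    exists2 u : 'rV[C]_n, u != 0 & forall x, u *m unitary_mx (rho x) = u.

(** Right multiplication is a right action on row vectors, whence the inverse. *)
Definition row_act n (rho : {multiplicative Gamma -> unitary_group R n}) (x : Gamma) :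
    {linear row_hilbert R n -> row_hilbert R n} :=
  mulmxr (unitary_mx (rho x^-1%g)).

Lemma row_act1 n (rho : {multiplicative Gamma -> unitary_group R n}) v :
  row_act rho 1%g v = v.
Proof. by rewrite /row_act /= invg1 hom1 mulmx1. Qed.

Lemma row_actM n (rho : {multiplicative Gamma -> unitary_group R n}) x y v :
  row_act rho (x * y)%g v = row_act rho x (row_act rho y v).
Proof. by rewrite /row_act /= invgM gmulfM unitary_mxM mulmxA. Qed.

Lemma row_act_inner n (rho : {multiplicative Gamma -> unitary_group R n}) x u v :
  inner (row_hilbert R n) (row_act rho x u) (row_act rho x v) =
  inner (row_hilbert R n) u v.
Proof.
change (dotmx (u *m unitary_mx (rho x^-1%g)) (v *m unitary_mx (rho x^-1%g)) = dotmx u v).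
by rewrite !dotmxE trmxC_mul mulmxA unitary_mxK.
Qed.

Definition row_rep n rho : unitary_rep Gamma (row_hilbert R n) :=
  UnitaryRep (row_act1 rho) (row_actM rho) (row_act_inner rho).

Lemma row_act_displacement n (rho : {multiplicative Gamma -> unitary_group R n}) x
    (v : 'rV[C]_n) :
  frob (v *m unitary_mx (rho x) - v) = frob (v *m unitary_mx (rho x^-1%g) - v).
Proof.
rewrite frobB -[RHS](frob_mulr _ (unitary_mxP (rho x))) mulmxBl homV unitary_mxV.
by rewrite unitary_mxKV.
Qed.

(** Halving the constant turns the non-strict bounds into a strict one. *)
Lemma kazhdan_pair_of_T : property_T R Gamma ->
  exists (Q : set Gamma) (kappa : R),
    [/\ finite_set Q, 0 < kappa & kazhdan_pair Q kappa].
Proof.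
move=> [Q [kappa [Qfin [k0 QT]]]]; exists Q, (kappa / 2); split=> //.
  by rewrite divr_gt0.
move=> n rho v v0 vQ; have fv0 : 0 < frob v by rewrite lt_def frob_eq0 v0 frob_ge0.
have lt_half : kappa / 2 * frob v < kappa * frob v.
  by rewrite ltr_pM2r // ltr_pdivrMr // ltr_pMr // ltr1n.
have [|u [u0 uP]] := QT _ (row_rep rho).
  exists v; split; first exact/eqP.
  rewrite {2}/hnorm /= frob_row; apply: le_lt_trans lt_half.
  have [->|/set0P E0] := eqVneq [set hnorm (row_rep rho x v - v) | x in Q] set0.
    by rewrite sup0 mulr_ge0 ?frob_ge0 // divr_ge0 ?ltW.
  apply: ge_sup => // _ [x Qx <-].
  have -> : hnorm (row_rep rho x v - v) = frob (v *m unitary_mx (rho x) - v).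
    exact: etrans (frob_row _) (esym (row_act_displacement rho x v)).
  exact: vQ.
exists u; first exact/eqP.
by move=> x; have := uP x^-1%g; rewrite /row_rep /= /row_act /= invgK.
Qed.

(** An invariant subspace is again a unitary matrix representation, in the
    coordinates of an orthonormal basis given by the rows of [B]. *)
Lemma subrepresentation n (rho : {multiplicative Gamma -> unitary_group R n})
    m (V : 'M[C]_(m, n)) :
  (forall x, (V *m unitary_mx (rho x) <= V)%MS) ->
  exists p (B : 'M[C]_(p, n)) (sigma : {multiplicative Gamma -> unitary_group R p}),
    [/\ B \is unitarymx, (B :=: V)%MS,
        forall x, unitary_mx (sigma x) = B *m unitary_mx (rho x) *m B^t* &
        forall x, B *m unitary_mx (rho x) = unitary_mx (sigma x) *m B].
Proof.
move=> Vinv; pose B := schmidt (row_base V).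
have BU : B \is unitarymx by rewrite schmidt_unitarymx // rank_leq_col.
have BV : (B :=: V)%MS.
  by apply: eqmx_trans (eq_row_base V); apply: eqmx_schmidt_free; exact: row_base_free.
have BBK p (D : 'M[C]_(p, n)) : (D <= B)%MS -> D *m B^t* *m B = D.
  by case/submxP => D' ->; rewrite mulmxtVK.
have Binv x : (B *m unitary_mx (rho x) <= B)%MS.
  by rewrite (eqmxMr _ BV) BV.
pose s x := B *m unitary_mx (rho x) *m B^t*.
have sU x : s x \is unitarymx.
  apply/unitarymxP; rewrite /s !trmxC_mul trmxCK !mulmxA BBK //.
  by rewrite unitary_mxK; apply/unitarymxP.
have sM : {morph (fun x => UnitaryMatrix (sU x)) : x y / (x * y)%g}.
  move=> x y; apply: val_inj; rewrite /= /s gmulfM unitary_mxM !mulmxA.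
  by rewrite BBK.
exists (\rank V), B, (hom_of sM); split=> // x.
by rewrite /= /s BBK.
Qed.

(** Property (T) bounds the distance of a vector to the invariant vectors: an
    almost invariant component in the complement [kermx P] would produce an
    invariant vector there, where the projection [P] leaves none. *)
Lemma kazhdan_projection (Q : set Gamma) (kappa : R) n
    (rho : {multiplicative Gamma -> unitary_group R n}) (P : 'M[C]_n) :
  kazhdan_pair Q kappa ->
  (forall x, P *m unitary_mx (rho x) = P) ->
  (forall x, unitary_mx (rho x) *m P = P) ->
  (forall u : 'rV[C]_n, (forall x, u *m unitary_mx (rho x) = u) -> u *m P = u) ->
  forall (v : 'rV[C]_n) (delta : R), 0 <= delta ->
  (forall x, Q x -> frob (v *m unitary_mx (rho x) - v) <= delta) ->
  kappa * frob (v - v *m P) <= delta.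
Proof.
move=> kQ Prho rhoP Pid v delta d0 vQ; rewrite leNgt; apply/negP => lt_delta.
have PP : P *m P = P.
  by apply/row_matrixP => i; rewrite row_mul Pid // => x; rewrite -row_mul Prho.
pose w := v - v *m P.
have [|p [B [sigma [BU BK sE sB]]]] := @subrepresentation n rho _ (kermx P).
  by move=> x; apply/sub_kermxP; rewrite -mulmxA rhoP mulmx_ker.
have wB : w *m B^t* *m B = w.
  have /submxP[D ->] : (w <= B)%MS; last by rewrite mulmxtVK.
  by rewrite BK; apply/sub_kermxP; rewrite mulmxBl -mulmxA PP subrr.
have BP : B *m P = 0 by apply/sub_kermxP; rewrite BK.
have fw : frob (w *m B^t*) = frob w by rewrite -(frob_mulr _ BU) wB.
have [|x Qx|u u0 uP] := kQ _ sigma (w *m B^t*).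
- apply: contraTneq lt_delta => w0; rewrite -leNgt.
  have -> : v - v *m P = 0 by rewrite -/w -wB w0 mul0mx.
  by have /eqP -> : frob (0 : 'rV[C]_n) == 0; rewrite ?frob_eq0 // mulr0.
- rewrite fw; apply: le_trans (ltW lt_delta); apply: le_trans (vQ x Qx).
  rewrite -(frob_mulr _ BU) mulmxBl wB.
  have -> : w *m B^t* *m unitary_mx (sigma x) *m B = w *m unitary_mx (rho x).
    by rewrite -(mulmxA _ (unitary_mx _)) -sB mulmxA wB.
  by rewrite /w mulmxBl -(mulmxA v) Prho opprB addrA addrNK.
have : u *m B = 0.
  rewrite -(Pid (u *m B)) => [|x]; first by rewrite -mulmxA BP mulmx0.
  by rewrite -mulmxA sB mulmxA uP.
move=> uB0; have := mulmxtVK u BU; rewrite uB0 mul0mx => u0'.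
by rewrite -u0' eqxx in u0.
Qed.

End MatrixPropertyT.

(** * Intertwiners and irreducible representations *)

Section Intertwiners.
Variables (R : realType) (Gamma : groupType).
Local Notation C := R[i].

Lemma unitary_of_isometry n (M : 'M[C]_n) :
  (forall u v : 'rV[C]_n, dotmx (u *m M) (v *m M) = dotmx u v) -> M \is unitarymx.
Proof.
move=> iso; apply/row_unitarymxP => i j; rewrite ![row _ M]rowE iso.
by rewrite -!row1; apply/row_unitarymxP/unitary1.
Qed.

(** The invariant vectors of [tau] are the intertwiners from [alpha] to [rho]. *)
Lemma intertwiner_rep m n (alpha : {multiplicative Gamma -> unitary_group R m})
    (rho : {multiplicative Gamma -> unitary_group R n}) :
  exists tau : {multiplicative Gamma -> unitary_group R (m * n)},
    forall x (T : 'M[C]_(m, n)), mxvec T *m unitary_mx (tau x) =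
      mxvec ((unitary_mx (alpha x))^t* *m T *m unitary_mx (rho x)).
Proof.
pose t x := lin_mx (mulmxr (unitary_mx (rho x)) \o mulmx ((unitary_mx (alpha x))^t*)).
have tE x (T : 'M[C]_(m, n)) : mxvec T *m t x =
    mxvec ((unitary_mx (alpha x))^t* *m T *m unitary_mx (rho x)).
  by rewrite mul_vec_lin.
have tU x : t x \is unitarymx.
  apply: unitary_of_isometry => u v; rewrite -(vec_mxK u) -(vec_mxK v) !tE !dot_mxvec.
  rewrite !trmxC_mul trmxCK !mulmxA unitary_mxK mxtrace_mulC !mulmxA.
  by rewrite -unitary_mxV -unitary_mxM mulgV unitary_mx1 mul1mx.
have tM : {morph (fun x => UnitaryMatrix (tU x)) : x y / (x * y)%g}.
  move=> x y; apply: val_inj => /=; apply/row_matrixP => i.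
  rewrite !rowE mulmxA -(vec_mxK (delta_mx 0 i)) !tE !gmulfM !unitary_mxM trmxC_mul.
  by rewrite !mulmxA.
by exists (hom_of tM) => x T; rewrite -tE.
Qed.

Lemma intertwiner_displacement m n (a : unitary_group R m) (b : unitary_group R n)
    (T : 'M[C]_(m, n)) :
  frob (mxvec ((unitary_mx a)^t* *m T *m unitary_mx b) - mxvec T) =
  frob (T *m unitary_mx b - unitary_mx a *m T).
Proof.
rewrite -linearB /= frob_mxvec -(frob_mull _ (unitary_mxP a)) mulmxBr !mulmxA.
by rewrite -unitary_mxV -unitary_mxM mulgV unitary_mx1 mul1mx.
Qed.

Lemma kazhdan_intertwiner (Q : set Gamma) (kappa : R) m n
    (alpha : {multiplicative Gamma -> unitary_group R m})
    (rho : {multiplicative Gamma -> unitary_group R n}) (T : 'M[C]_(m, n)) :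
  kazhdan_pair Q kappa -> T != 0 ->
  (forall x, Q x ->
     frob (T *m unitary_mx (rho x) - unitary_mx (alpha x) *m T) <= kappa * frob T) ->
  exists2 T' : 'M[C]_(m, n), T' != 0 &
    forall x, T' *m unitary_mx (rho x) = unitary_mx (alpha x) *m T'.
Proof.
move=> kQ T0 TQ; have [tau tauE] := intertwiner_rep alpha rho.
have [||u u0 uP] := kQ _ tau (mxvec T).
- by rewrite mxvec_eq0.
- by move=> x Qx; rewrite tauE intertwiner_displacement frob_mxvec TQ.
exists (vec_mx u); first by rewrite vec_mx_eq0.
move=> x; rewrite -{2}(uP x) -{2}(vec_mxK u) tauE mxvecK !mulmxA.
by rewrite -unitary_mxV -unitary_mxM mulgV unitary_mx1 mul1mx.
Qed.

(** For unitary representations a trivial commutant means that there are no proper invariant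
    subspaces; this form is the one that Schur's lemma uses. *)
Definition irreducible n (rho : {multiplicative Gamma -> unitary_group R n}) :=
  forall Z : 'M[C]_n,
    (forall x, Z *m unitary_mx (rho x) = unitary_mx (rho x) *m Z) -> is_scalar_mx Z.

(** [T^* T] lies in the commutant of [rho], so it is a nonzero scalar
    and [T] is injective on column vectors. *)
Lemma schur_intertwiner m n (alpha : {multiplicative Gamma -> unitary_group R m})
    (rho : {multiplicative Gamma -> unitary_group R n}) (T : 'M[C]_(m, n)) :
  irreducible rho -> T != 0 ->
  (forall x, T *m unitary_mx (rho x) = unitary_mx (alpha x) *m T) ->
  row_full T.
Proof.
move=> irr T0 TP.
have TPC x : T^t* *m unitary_mx (alpha x) = unitary_mx (rho x) *m T^t*.
  have := TP x^-1%g; rewrite !homV !unitary_mxV.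
  by move=> /(congr1 (fun A => A^t*)); rewrite !trmxC_mul !trmxCK.
have /is_scalar_mxP[a aE] : is_scalar_mx (T^t* *m T).
  by apply: irr => x; rewrite -mulmxA TP mulmxA TPC mulmxA.
have a0 : a != 0.
  apply: contraNneq T0 => a0; rewrite -frob_eq0 -sqrf_eq0 frob_sqr mxtrace_mulC aE a0.
  by rewrite raddf0 mxtrace0.
rewrite -sub1mx; have -> : 1%:M = (a^-1 *: T^t*) *m T.
  by rewrite -scalemxAl aE scale_scalar_mx mulVf.
exact: submxMl.
Qed.

Lemma row_full_cancel m n p (T : 'M[C]_(m, n)) (A B : 'M[C]_(n, p)) :
  row_full T -> T *m A = T *m B -> A = B.
Proof.
by move=> /row_fullP[T' T'K] AB; rewrite -[A]mul1mx -T'K -mulmxA AB mulmxA T'K mul1mx.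
Qed.

Definition has_finite_image n (rho : {multiplicative Gamma -> unitary_group R n}) :=
  finite_set (range (fun x => unitary_mx (rho x))).

Lemma sub_finite_image n p (rho : {multiplicative Gamma -> unitary_group R n})
    (sigma : {multiplicative Gamma -> unitary_group R p}) (B : 'M[C]_(p, n)) :
  (forall x, unitary_mx (sigma x) = B *m unitary_mx (rho x) *m B^t*) ->
  has_finite_image rho -> has_finite_image sigma.
Proof.
move=> sE /(finite_image (fun A => B *m A *m B^t*)).
apply: sub_finite_set => _ [x _ <-]; exists (unitary_mx (rho x)); last by rewrite sE.
by exists x.
Qed.

Lemma rank_orthocomplement p n (B : 'M[C]_(p, n)) :
  B \is unitarymx -> \rank (kermx (B^t*)) = (n - p)%N.
Proof. by move=> BU; rewrite mxrank_ker mxrank_map mxrank_tr mxrank_unitary. Qed.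

Lemma eq_on_orthogonal_sum p q n m (B : 'M[C]_(p, n)) (D : 'M[C]_(q, n)) (X Y : 'M[C]_(n, m)) :
  B \is unitarymx -> (D :=: kermx (B^t*))%MS ->
  B *m X = B *m Y -> D *m X = D *m Y -> X = Y.
Proof.
move=> BU DB BX DX.
have /submxP[E EP] : (1%:M - B^t* *m B <= D)%MS.
  rewrite DB; apply/sub_kermxP; rewrite mulmxBl mul1mx -mulmxA.
  by rewrite (unitarymxP BU) mulmx1 subrr.
rewrite -[X]mul1mx -[Y]mul1mx -(subrK (B^t* *m B) 1%:M) EP !mulmxDl.
by rewrite -!mulmxA BX DX.
Qed.

(** A nonscalar element of the commutant has a proper eigenspace, which splits the
    representation orthogonally; some iterated summand still separates [x] from [y]. *)
Lemma irreducible_separates n (rho : {multiplicative Gamma -> unitary_group R n}) x y :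
  has_finite_image rho -> unitary_mx (rho x) != unitary_mx (rho y) ->
  exists m (sigma : {multiplicative Gamma -> unitary_group R m}),
    [/\ irreducible sigma, has_finite_image sigma & unitary_mx (sigma x) != unitary_mx (sigma y)].
Proof.
have [k] := ubnP n; elim: k n rho => // k IHk n rho; rewrite ltnS => n_le fin xy.
have [irr|/existsNP[Z /not_implyP[Zcomm Znscal]]] := pselect (irreducible rho).
  by exists n, rho.
have n0 : (0 < n)%N.
  rewrite lt0n; apply: contraNneq xy => n0; apply/eqP/matrixP => i.
  by have := ltn_ord i; rewrite {2}n0.
have [a Va] := eigenvalue_closed Z n0; pose V := eigenspace Z a.
have V_lt : (\rank V < n)%N.
  rewrite ltn_neqAle rank_leq_row andbT; apply/negP => Vfull.
  apply: Znscal; apply/is_scalar_mxP; exists a.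
  have /eigenspaceP : (1%:M <= V)%MS by rewrite sub1mx.
  by rewrite mul1mx scalemx1.
have [|p [B [sigma [BU BV sE sB]]]] := @subrepresentation _ _ _ rho _ V.
  move=> g; apply/eigenspaceP; rewrite -mulmxA -Zcomm mulmxA.
  by rewrite (eigenspaceP (submx_refl V)) -scalemxAl.
have pV : p = \rank V by rewrite -(mxrank_unitary BU) BV.
pose W := kermx (B^t*).
have [|q [D [tau [DU DW tE tD]]]] := @subrepresentation _ _ _ rho _ W.
  move=> g; apply/sub_kermxP.
  have -> : W *m unitary_mx (rho g) *m B^t* = W *m (B *m unitary_mx (rho g^-1%g))^t*.
    by rewrite trmxC_mul homV unitary_mxV trmxCK mulmxA.
  by rewrite sB trmxC_mul mulmxA mulmx_ker mul0mx.
have q_lt : (q < n)%N.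
  rewrite -(mxrank_unitary DU) DW rank_orthocomplement // pV.
  by rewrite ltn_subrL n0 lt0n mxrank_eq0 andbT.
have [sxy|] := eqVneq (unitary_mx (sigma x)) (unitary_mx (sigma y)); last first.
  apply: IHk; last exact: sub_finite_image sE fin.
  by apply: leq_trans n_le; rewrite pV.
have [txy|] := eqVneq (unitary_mx (tau x)) (unitary_mx (tau y)); last first.
  apply: IHk; last exact: sub_finite_image tE fin.
  exact: leq_trans q_lt n_le.
case/eqP: xy; apply: (eq_on_orthogonal_sum BU DW).
  by rewrite (sB x) (sB y) sxy.
by rewrite (tD x) (tD y) txy.
Qed.

End Intertwiners.

(** * Total boundedness of unitary groups *)

Section Rounding.
Variable R : realType.
Local Notation C := R[i].
Local Notation Re := (@complex.Re R).
Local Notation Im := (@complex.Im R).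

(** Round to a grid of step [delta]. *)
Lemma round_segment (delta : R) : 0 < delta ->
  exists n (c : R -> 'I_n.+1), forall x y, `|x| <= 1 -> `|y| <= 1 ->
    c x = c y -> (x - y) ^+ 2 <= delta ^+ 2.
Proof.
move=> d0; pose t x := Num.trunc ((x + 1) / delta).
have t_le x : `|x| <= 1 -> (t x <= t 1%R)%N.
  move=> /ler_normlP[_ x1]; apply: le_truncn.
  by rewrite ler_pM2r ?invr_gt0 // lerD2r.
exists (t 1), (fun x => inord (t x)) => x y x1 y1.
move=> /(congr1 (fun i : 'I_(t 1%R).+1 => val i)) /=; rewrite !inordK ?ltnS ?t_le // => txy.
have bnd z : `|z| <= 1 -> (t z)%:R * delta <= z + 1 < ((t z).+1)%:R * delta.
  move=> /ler_normlP[z1 _]; rewrite -ler_pdivlMr // -ltr_pdivrMr //.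
  apply: truncn_itv; rewrite divr_ge0 ?(ltW d0) //.
  by rewrite -lerBlDr sub0r lerNl.
have := bnd x x1; have := bnd y y1; rewrite txy -natr1 mulrDl mul1r.
move=> /andP[y_ge y_lt] /andP[x_ge x_lt].
have xy_le : x - y <= delta by lra.
have yx_le : y - x <= delta by lra.
nra.
Qed.

Lemma unitary_entry n (A : 'M[C]_n) i j : A \is unitarymx -> sqmod (A i j) <= 1.
Proof.
move=> AU; have := unitarymxP AU => /(congr1 (fun M : 'M[C]_n => Re (M i i))).
rewrite !mxE eqxx Re_sum /= => <-; rewrite (bigD1 j) //= !mxE Re_mul_conj lerDl.
by apply: sumr_ge0 => k _; rewrite !mxE Re_mul_conj sqmod_ge0.
Qed.

(** Total boundedness, by rounding the real and imaginary parts of the entries, which lie in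
    the segment from -1 to 1. *)
Lemma round_unitary n (e : R) : 0 < e ->
  exists (T : finType) (c : unitary_group R n -> T), forall a b, c a = c b ->
    frob (unitary_mx a - unitary_mx b) <= e.
Proof.
move=> e0.
have [delta d0 ->] : exists2 delta, 0 < delta & e = delta * (2 * (n%:R + 1)).
  exists (e / (2 * n.+1%:R)); first by rewrite divr_gt0 // mulr_gt0.
  by rewrite natr1 divfK // mulf_neq0 // pnatr_eq0.
have [N [c cP]] := round_segment d0.
exists {ffun 'I_n * 'I_n -> 'I_N.+1 * 'I_N.+1}.
exists (fun a => [ffun ij => (c (Re (unitary_mx a ij.1 ij.2)), c (Im (unitary_mx a ij.1 ij.2)))]).
move=> a b /ffunP ab.
have small (z : C) : sqmod z <= 1 -> `|Re z| <= 1 /\ `|Im z| <= 1.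
  have := sqr_ge0 (Re z); have := sqr_ge0 (Im z); rewrite /sqmod => *.
  by split; rewrite -(ler_sqr (normr_ge0 _)) ?nnegrE // expr1n real_normK ?num_real //; lra.
rewrite -ler_sqr ?nnegrE ?frob_ge0 ?mulr_ge0 ?addr_ge0 ?(ltW d0) // frob_sqrE.
apply: (@le_trans _ _ (\sum_(i < n) \sum_(j < n) 2 * delta ^+ 2)).
  apply: ler_sum => i _; apply: ler_sum => j _.
  have := ab (i, j); rewrite !ffunE /= => -[reE imE].
  have [ra ia] := small _ (unitary_entry i j (unitary_mxP a)).
  have [rb ib] := small _ (unitary_entry i j (unitary_mxP b)).
  have := cP _ _ ra rb reE; have := cP _ _ ia ib imE.
  by rewrite /sqmod !mxE ReD ReN ImD ImN; lra.
rewrite !sumr_const card_ord -[_ *+ n]mulr_natr -[_ *+ n]mulr_natr.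
have : (0 : R) <= n%:R by []; have := sqr_ge0 delta.
rewrite exprMn; move: (n%:R : R) (delta ^+ 2) => m q q0 m0.
have : 0 <= q * m by rewrite mulr_ge0.
have : 0 <= q * m * m by rewrite !mulr_ge0.
nra.
Qed.

End Rounding.

(** * Irreducible representations of unbounded dimension *)

Section FewIrreducibles.
Variables (R : realType) (Gamma : groupType).
Local Notation C := R[i].

Lemma finite_range_code (X : Type) (f : Gamma -> X) : finite_set (range f) ->
  exists (T : finType) (c : Gamma -> T), forall x y, c x = c y -> f x = f y.
Proof.
elim/Pchoice: X f => X f /finite_fsetP[F FE].
have inF x : f x \in F by have : range f (f x) by [exists x]; rewrite FE.
exists F, (fun x => [` inF x]%fset) => x y; exact: (congr1 val).
Qed.

(** Two irreducible representations with close values on [Q] are intertwined, hence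
    identify the same pairs of elements; by total boundedness of the unitary group
    only finitely many kernels occur. *)
Lemma few_irreducibles_eq (Q : set Gamma) (kappa : R) n :
  finite_set Q -> 0 < kappa -> kazhdan_pair Q kappa ->
  exists (T : finType) (c : Gamma -> T), forall x y, c x = c y ->
    forall rho : {multiplicative Gamma -> unitary_group R n},
      irreducible rho -> has_finite_image rho -> unitary_mx (rho x) = unitary_mx (rho y).
Proof.
move=> /finite_fsetP[F FE] k0 kQ.
have [->|n0] := posnP n.
  by exists unit, (fun=> tt) => x y _ rho _ _; apply/matrixP => -[].
have one0 : (1%:M : 'M[C]_n) != 0 by rewrite -mxrank_eq0 mxrank1 -lt0n.
have f0 : 0 < kappa * frob (1%:M : 'M[C]_n).
  by rewrite mulr_gt0 // lt_def frob_eq0 one0 frob_ge0.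
have [U [r rP]] := round_unitary n f0.
pose code (rho : {multiplicative Gamma -> unitary_group R n}) :=
  [ffun q : F => r (rho (val q))].
have same (rho sigma : {multiplicative Gamma -> unitary_group R n}) :
    code rho = code sigma -> irreducible sigma ->
    forall x y, unitary_mx (rho x) = unitary_mx (rho y) ->
      unitary_mx (sigma x) = unitary_mx (sigma y).
  move=> /ffunP codeE irr x y rxy.
  have [|T T0 TP] := @kazhdan_intertwiner _ _ _ _ _ _ rho sigma 1%:M kQ one0.
    move=> q; rewrite FE => qF; rewrite mul1mx mulmx1; apply: rP.
    by have := codeE [` qF]%fset; rewrite !ffunE => ->.
  apply: (row_full_cancel (schur_intertwiner irr T0 TP)).
  by rewrite !TP rxy.
have /(_ _)/cid-/all_tag[T /(_ _)/cid-/all_tag[c cP]] t : exists (T : finType) (c : Gamma -> T),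
    forall rho, irreducible rho -> has_finite_image rho -> code rho = t ->
    forall x y, c x = c y -> unitary_mx (rho x) = unitary_mx (rho y).
  have [[rho [irr fin <-]]|none] := pselect (exists rho,
      [/\ irreducible rho, has_finite_image rho & code rho = t]).
    have [T [c cP]] := finite_range_code fin.
    exists T, c => sigma sirr _ sE x y /cP; exact: same.
  exists unit, (fun=> tt) => rho irr fin rt; case: none; by exists rho.
exists {dffun forall t, T t}, (fun x => [ffun t => c t x]) => x y /ffunP cxy rho irr fin.
by apply: (cP (code rho)) => //; have := cxy (code rho); rewrite !ffunE.
Qed.

Lemma few_irreducibles (Q : set Gamma) (kappa : R) d :
  finite_set Q -> 0 < kappa -> kazhdan_pair Q kappa ->
  exists (T : finType) (c : Gamma -> T), forall x y, c x = c y ->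
    forall n (rho : {multiplicative Gamma -> unitary_group R n}), (n < d)%N ->
      irreducible rho -> has_finite_image rho -> unitary_mx (rho x) = unitary_mx (rho y).
Proof.
move=> Qfin k0 kQ; elim: d => [|d [T [c cP]]]; first by exists unit, (fun=> tt).
have [U [u uP]] := few_irreducibles_eq d Qfin k0 kQ.
exists (T * U)%type, (fun x => (c x, u x)) => x y [cxy uxy] n rho.
rewrite ltnS leq_eqVlt => /predU1P[nd|]; last exact: cP.
by move: rho; rewrite nd => rho irr fin; exact: (uP x y uxy).
Qed.

Definition perm_unitary n (s : {perm 'I_n}) : unitary_group R n.
Proof.
exists (perm_mx s); apply/unitarymxP; rewrite tr_perm_mx map_perm_mx -perm_mxM.
by rewrite mulgV perm_mx1.
Defined.

Lemma perm_unitaryM n : {morph @perm_unitary n : s t / (s * t)%g}.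
Proof. by move=> s t; apply: val_inj; exact: perm_mxM. Qed.

Definition perm_rep n (phi : {multiplicative Gamma -> {perm 'I_n}}) :
    {multiplicative Gamma -> unitary_group R n} :=
  hom_of (fun x y => etrans (congr1 (@perm_unitary n) (gmulfM x y))
    (perm_unitaryM (phi x) (phi y))).

Lemma perm_rep_finite_image n (phi : {multiplicative Gamma -> {perm 'I_n}}) :
  has_finite_image (perm_rep phi).
Proof.
apply: (@sub_finite_set _ _ (range (@perm_mx C n))).
  by move=> _ [x _ <-]; exists (phi x).
by apply: finite_image; exact: finite_finset.
Qed.

Lemma perm_mx_inj n : injective (@perm_mx C n).
Proof.
move=> s t /matrixP st; apply/permP => i.
have := st i (s i); rewrite !mxE eqxx.
by case: (t i =P s i) => // _ /eqP; rewrite oner_eq0.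
Qed.

(** Permutation representations split into irreducible ones, so if the latter had
    bounded degree then all transitive actions would factor through one finite
    quotient set of the group. *)
Lemma large_irreducible (Q : set Gamma) (kappa : R) :
  finite_set Q -> 0 < kappa -> kazhdan_pair Q kappa ->
  (forall d, exists n (phi : {multiplicative Gamma -> {perm 'I_n}}),
    (d <= n)%N /\ transitive_action phi) ->
  forall d, exists n (rho : {multiplicative Gamma -> unitary_group R n}),
    (d <= n)%N /\ irreducible rho.
Proof.
move=> Qfin k0 kQ large d; apply: contrapT => small.
have [T [c cP]] := few_irreducibles d Qfin k0 kQ.
have [n [phi [n_gt tr]]] := large #|T|.+1.
have c_phi x y : c x = c y -> phi x = phi y.
  move=> cxy; apply/eqP; apply: contrapT => /negP phixy.
  have pxy : unitary_mx (perm_rep phi x) != unitary_mx (perm_rep phi y).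
    by rewrite /= (inj_eq (@perm_mx_inj n)).
  have [m [sigma [irr fin /eqP]]] := irreducible_separates (perm_rep_finite_image phi) pxy.
  apply; apply: (cP x y cxy) => //.
  by rewrite ltnNge; apply/negP => dm; apply: small; exists m, sigma.
case: n phi n_gt tr c_phi => // n phi n_gt tr c_phi.
have [g gP] := choice (tr ord0).
suff : (#|'I_n.+1| <= #|T|)%N by rewrite card_ord leqNgt n_gt.
apply: (@leq_card _ _ (fun i => c (g i))) => i j /c_phi gij.
by rewrite -(gP i) -(gP j) gij.
Qed.

End FewIrreducibles.

(** * The inclusion of a corner *)

Section Corner.
Variable R : realType.
Local Notation C := R[i].

Definition corner_incl n : 'M[C]_(n, 1 + n) := row_mx 0 1%:M.

Lemma corner_inclE n i j : corner_incl n i j = (j == lift ord0 i)%:R.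
Proof.
rewrite /corner_incl mxE; case: splitP => k jk; rewrite mxE.
  by case: eqP => // jE; have := congr1 val jE; rewrite /= jk ord1.
congr (_%:R); congr nat_of_bool; apply/eqP/eqP => [->|jE]; apply/val_inj => /=.
  by rewrite jk.
by have := congr1 val jE; rewrite /= jk => /addnI.
Qed.

Lemma corner_incl_unitary n : corner_incl n \is unitarymx.
Proof.
apply/unitarymxP; rewrite /corner_incl tr_row_mx map_col_mx mul_row_col.
by rewrite trmx0 map_mx0 mulmx0 add0r trmx1 map_mx1 mulmx1.
Qed.

Lemma frob_unitary m n (U : 'M[C]_(m, n)) : U \is unitarymx -> frob U ^+ 2 = m%:R.
Proof.
move=> /unitarymxP UU; rewrite frob_sqr UU mxtrace1.
by rewrite -[LHS]/(complex.Re (m%:R)) -(rmorph_nat (real_complex R)).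
Qed.

Lemma corner_incl_mul n p (B : 'M[C]_(1 + n, p)) i j :
  (corner_incl n *m B) i j = B (lift ord0 i) j.
Proof.
rewrite mxE (bigD1 (lift ord0 i)) //= corner_inclE eqxx mul1r big1 ?addr0 // => k ki.
by rewrite corner_inclE (negPf ki) mul0r.
Qed.

Lemma frob_corner_le n p (B : 'M[C]_(1 + n, p)) : frob (corner_incl n *m B) <= frob B.
Proof.
rewrite -ler_sqr ?nnegrE ?frob_ge0 // !frob_sqrE [X in _ <= X]big_ord_recl.
under eq_bigr => i _ do under eq_bigr => j _ do rewrite corner_incl_mul.
by rewrite lerDr; apply: sumr_ge0 => j _; exact: sqmod_ge0.
Qed.

Lemma corner_incl_block n (A : 'M[C]_n) :
  corner_incl n *m lift0_mx A = A *m corner_incl n.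
Proof.
rewrite /corner_incl /lift0_mx mul_row_block mul_mx_row.
by rewrite !mul0mx !mulmx0 !mul1mx !add0r mulmx1.
Qed.

Lemma frob_corner_defect n (A : 'M[C]_n) (X : 'M[C]_(1 + n)) :
  frob (corner_incl n *m X - A *m corner_incl n) <= frob (lift0_mx A - X).
Proof. by rewrite -corner_incl_block -mulmxBr frobB; exact: frob_corner_le. Qed.

End Corner.

(** * Unitary matrices close to a corner *)

Section UnitaryCorner.
Variable R : realType.
Local Notation C := R[i].
Local Notation Re := (@complex.Re R).
Local Notation Im := (@complex.Im R).

Lemma lift0_unitary n (A : 'M[C]_n) : A \is unitarymx -> lift0_mx A \is unitarymx.
Proof.
move=> /unitarymxP AA; apply/unitarymxP; rewrite /lift0_mx tr_block_mx map_block_mx.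
rewrite mulmx_block !trmx0 !map_mx0 trmx1 map_mx1 !mulmx0 !mul0mx AA mulmx1.
by rewrite !addr0 !add0r -scalar_mx_block.
Qed.

Definition unitary_lift n (A : unitary_group R n) : unitary_group R n.+1 :=
  UnitaryMatrix (lift0_unitary (unitary_mxP A)).

Lemma unitary_liftM n : {morph @unitary_lift n : A B / (A * B)%g}.
Proof.
move=> A B; apply: val_inj.
change (lift0_mx (unitary_mx A *m unitary_mx B) =
  lift0_mx (unitary_mx A) *m lift0_mx (unitary_mx B)).
rewrite /lift0_mx mulmx_block.
by rewrite !mulmx0 !mul0mx !addr0 !add0r mulmx1.
Qed.

Lemma frob_lift0B n (A B : 'M[C]_n) : frob (lift0_mx A - lift0_mx B) = frob (A - B).
Proof.
have -> : lift0_mx A - lift0_mx B = block_mx 0 0 0 (A - B).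
  by rewrite /lift0_mx opp_block_mx add_block_mx !subrr.
apply: eq_frob; rewrite tr_block_mx map_block_mx mulmx_block !trmx0 !map_mx0.
by rewrite !mulmx0 !mul0mx !addr0 !add0r mxtrace_block mxtrace0 add0r.
Qed.

Lemma lift0_mx_of_row n (Y : 'M[C]_(1 + n)) : Y \is unitarymx ->
  row 0 Y = delta_mx 0 0 -> exists2 A : 'M[C]_n, A \is unitarymx & Y = lift0_mx A.
Proof.
move=> YU row0.
have col0 i : Y i 0 = (i == 0)%:R.
  have : row 0 (Y^t*) = delta_mx 0 0.
    rewrite rowE; have := row0; rewrite rowE => {1}<-.
    by rewrite mulmxtVK.
  move=> /rowP/(_ i); rewrite !mxE => /(congr1 conjC); rewrite conjCK => ->.
  by rewrite eqxx /= conjC_nat.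
have row0E j : Y 0 j = (j == 0)%:R by have /rowP/(_ j) := row0; rewrite !mxE eqxx.
have YE : Y = lift0_mx (drsubmx Y).
  rewrite -[LHS]submxK /lift0_mx; congr block_mx; apply/matrixP => i j.
  - by rewrite !mxE !ord1 lshift0 row0E.
  - by rewrite !mxE ord1 lshift0 row0E.
  - by rewrite !mxE ord1 lshift0 col0.
exists (drsubmx Y) => //; apply/unitarymxP; move/unitarymxP: YU; rewrite {1 2}YE.
rewrite /lift0_mx tr_block_mx map_block_mx mulmx_block scalar_mx_block.
by move=> /eq_block_mx[_ _ _]; rewrite trmx0 map_mx0 mulmx0 add0r.
Qed.

(** [S] is the complex reflection [1 - c w^* w] along [w = u - e], where the inverse
    [a] of [c] is the inner product of [u] with [w], so that [u] goes to [u - w]. It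
    is unitary because the squared norm of [w] is [a + conj a]. The norm of [S - 1]
    is bounded independently of the dimension because [S - 1] has rank at most 1. *)
Lemma unitary_reflection n (u e : 'rV[C]_n) : u *m u^t* = 1%:M -> e *m e^t* = 1%:M ->
  exists S : 'M[C]_n, [/\ S \is unitarymx, u *m S = e & frob (S - 1%:M) <= 2].
Proof.
move=> uu ee; pose w := u - e; pose a := (u *m w^t*) 0 0.
have uw : u *m w^t* = a%:M by rewrite [LHS]mx11_scalar.
have wtr : w^t* = u^t* - e^t* by rewrite /w linearB /= map_mxB.
have aE : a = 1 - (u *m e^t*) 0 0.
  by rewrite /a wtr mulmxBr uu mxE mxE [in X in _ + X]mxE.
have acE : conjC a = 1 - (e *m u^t*) 0 0.
  rewrite aE rmorphB rmorph1; congr (_ - _).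
  by have /matrixP/(_ 0 0) := trmxC_mul u (e^t*); rewrite trmxCK !mxE.
have ww : w *m w^t* = (a + conjC a)%:M.
  rewrite [LHS]mx11_scalar; congr (_%:M).
  rewrite {1}/w mulmxBl wtr !mulmxBr uu ee acE aE !mxE /=.
  by ring.
have wE : u - w = e by rewrite /w opprB addrCA subrr addr0.
pose s := a + conjC a.
have {}ww : w *m w^t* = s%:M by [].
have {}aE : s = a + conjC a by [].
(* Only these relations between s, w and a matter from here on; if u = e then a = 0
   and S = 1 *)
clearbody s w a; clear wtr acE.
pose c := a^-1; pose K := w^t* *m w; pose S := 1%:M - c *: K.
have scE : c + conjC c = c * conjC c * s.
  have [a0|a0] := eqVneq a 0; first by rewrite /c a0 invr0 !conjC0 !(addr0, mul0r).
  have ac0 : conjC a != 0 by rewrite conjC_eq0.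
  by rewrite aE /c fmorphV; field; rewrite a0 ac0.
have Kt : K^t* = K by rewrite /K trmxC_mul trmxCK.
have StE : S^t* = 1%:M - conjC c *: K.
  by rewrite /S linearB /= map_mxB trmx1 map_mx1 linearZ /= map_mxZ Kt.
have KK : K *m K = s *: K.
  by rewrite /K mulmxA -(mulmxA _ w) ww mul_mx_scalar -scalemxAl.
have trK : \tr K = s by rewrite /K mxtrace_mulC ww mxtrace_scalar.
exists S; split.
- apply/unitarymxP; rewrite StE /S mulmxBl mul1mx mulmxBr mulmx1.
  rewrite -scalemxAl -scalemxAr KK !scalerA opprB -addrA; apply/eqP.
  rewrite -subr_eq0 addrAC subrr add0r -scaleNr -scaleNr -!scalerDl; apply/eqP.
  suff -> : - conjC c + (c * conjC c * s - c) = 0 by rewrite scale0r.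
  by rewrite -scE; ring.
- rewrite /S mulmxBr mulmx1 -scalemxAr /K mulmxA uw mul_scalar_mx scalerA.
  have [a0|a0] := eqVneq a 0; last by rewrite mulVf // scale1r.
  have /eqP : w = 0.
    apply/eqP; rewrite -frob_eq0 -sqrf_eq0 frob_sqr ww aE a0 conjC0 addr0 raddf0 mxtrace0 //.
  by rewrite a0 mulr0 scale0r -wE => /eqP ->; rewrite !subr0.
- rewrite -ler_sqr ?nnegrE ?frob_ge0 // /S addrAC subrr add0r frobN frob_sqr.
  rewrite linearZ /= map_mxZ Kt -scalemxAl -scalemxAr KK !linearZ /= trK.
  have -> : c * (conjC c * (s * s)) = (c + conjC c) * s by rewrite scE; ring.
  rewrite aE /c; case: a {uw ww aE scE StE trK KK c S} => p q.
  have conjE (z : C) : conjC z = conjc z by [].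
  rewrite !conjE; change (((p / (p ^+ 2 + q ^+ 2) + p / (p ^+ 2 + q ^+ 2)) * (p + p) -
    ((- (q / (p ^+ 2 + q ^+ 2))) + - - (q / (p ^+ 2 + q ^+ 2))) * (q + - q)) <= 2 ^+ 2).
  rewrite [q + - q]subrr mulr0 subr0.
  have [n0|n0] := eqVneq (p ^+ 2 + q ^+ 2) 0; first by rewrite n0 invr0 !mulr0 addr0 mul0r; lra.
  have npos : 0 < p ^+ 2 + q ^+ 2 by rewrite lt_def n0 addr_ge0 ?sqr_ge0.
  have -> : (p / (p ^+ 2 + q ^+ 2) + p / (p ^+ 2 + q ^+ 2)) * (p + p) =
    4 * p ^+ 2 / (p ^+ 2 + q ^+ 2) by ring.
  rewrite ler_pdivrMr //; have := sqr_ge0 q; lra.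
Qed.

End UnitaryCorner.

(** * The unitary case *)

Section HilbertSchmidtCase.
Variable R : realType.
Local Notation C := R[i].

Lemma hs_distE n (A B : unitary_group R n) :
  hs_dist A B = frob (unitary_mx A - unitary_mx B) / Num.sqrt n%:R.
Proof. exact: frob_hs_norm. Qed.

Definition unitary_iota n : {multiplicative unitary_family R n -> unitary_family R n.+1} :=
  hom_of (@unitary_liftM R n.+1).

Lemma sqrtS_le n : Num.sqrt n.+2%:R <= 2 * Num.sqrt n.+1%:R :> R.
Proof.
have -> : 2 = Num.sqrt (2 ^+ 2) :> R by rewrite sqrtr_sqr ger0_norm.
rewrite -sqrtrM ?sqr_ge0 // ler_sqrt ?mulr_ge0 //.
by rewrite -natrX -natrM ler_nat; lia.
Qed.

Lemma unitary_iota_expand n (A B : unitary_family R n) :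
  fam_dist A B <= 2 * fam_dist (unitary_iota n A) (unitary_iota n B).
Proof.
rewrite /fam_dist /= !hs_distE /= frob_lift0B mulrCA ler_wpM2l ?frob_ge0 //.
by rewrite ler_pdivlMr ?sqrtr_gt0 // mulrC ler_pdivrMr ?sqrtr_gt0 // sqrtS_le.
Qed.

Lemma unitary_iota_contract n (A B : unitary_family R n) :
  fam_dist (unitary_iota n A) (unitary_iota n B) <= fam_dist A B.
Proof.
rewrite /fam_dist /= !hs_distE /= frob_lift0B ler_wpM2l ?frob_ge0 //.
by rewrite lef_pV2 ?posrE ?sqrtr_gt0 // ler_sqrt // ler_nat.
Qed.

(** A reflection brings the image of the first basis vector back to this vector. Its unnormalized
    distance to the identity is at most 2, which the normalization makes small. *)
Lemma unitary_iota_dense n (X : unitary_family R n.+1) :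
  exists A : unitary_family R n, fam_dist (unitary_iota n A) X <= 2 / Num.sqrt n.+1%:R.
Proof.
pose x := unitary_mx (X : unitary_group R n.+2).
pose e : 'rV[C]_(1 + n.+1) := delta_mx 0 0.
have ee : e *m e^t* = 1%:M.
  by rewrite /e trmx_delta map_delta_mx mul_delta_mx; apply/matrixP => i j; rewrite !mxE !ord1.
have uu : (e *m x) *m (e *m x)^t* = 1%:M by rewrite trmxC_mul mulmxA unitary_mxK.
have [S [SU uS S_le]] := unitary_reflection uu ee.
have YU : x *m S \is unitarymx := mul_unitarymx (unitary_mxP X) SU.
have [|A AU YE] := lift0_mx_of_row YU; first by rewrite rowE mulmxA uS.
exists (UnitaryMatrix AU); rewrite /fam_dist /= hs_distE /= -YE.
have -> : x *m S - unitary_mx (X : unitary_group R n.+2) = x *m (S - 1%:M).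
  by rewrite mulmxBr mulmx1.
rewrite frob_mull ?unitary_mxP //; apply: ler_pM; rewrite ?frob_ge0 ?invr_ge0 //.
by rewrite lef_pV2 ?posrE ?sqrtr_gt0 // ler_sqrt // ler_nat.
Qed.

Lemma sqrt_harmonic_cvg : (2 / Num.sqrt n.+1%:R) @[n --> \oo] --> (0 : R).
Proof.
have := cvg_comp _ _ (@cvg_harmonic R) (@sqrt_continuous R 0); rewrite sqrtr0 => sq0.
have := cvgM (cvg_cst (2 : R)) sq0; rewrite mulr0 => h.
suff -> : (fun n : nat => 2 / Num.sqrt n.+1%:R : R) =
    (fun n => cst 2 n * (Num.sqrt \o harmonic) n) by exact: h.
by apply/funext => n; rewrite /= sqrtrV.
Qed.

Variables (Gamma : groupType).

Lemma unitary_stable_bounded : property_T R Gamma -> stable (unitary_family R) Gamma ->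
  ~ (forall d, exists n (phi : {multiplicative Gamma -> {perm 'I_n}}),
    (d <= n)%N /\ transitive_action phi).
Proof.
move=> /kazhdan_pair_of_T[Q [kappa [Qfin k0 kQ]]] [S [pi [pi_surj pi_st]]] large.
have large_irr := large_irreducible Qfin k0 kQ large.
have [|n [rho [psi [irr close]]]] := stable_shrink unitary_iota_expand
  unitary_iota_contract unitary_iota_dense sqrt_harmonic_cvg pi_surj pi_st
  (P := fun n (rho : {multiplicative Gamma -> unitary_group R n.+2}) => irreducible rho)
  _ Qfin (e := kappa / 2) (divr_gt0 k0 (ltr0Sn _ _)).
  move=> d; have [[|[|n]] [rho [dn irr]]] := large_irr d.+2 => //.
  by exists n, rho.
have T0 : corner_incl R n.+1 != 0.
  by rewrite -frob_eq0 -sqrf_eq0 frob_unitary ?corner_incl_unitary // pnatr_eq0.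
have [|T' T'0 T'P] := @kazhdan_intertwiner _ _ _ _ _ _ psi rho _ kQ T0.
  move=> x Qx; apply: le_trans (frob_corner_defect _ _) _.
  have := close x Qx; rewrite /fam_dist /= hs_distE /= ltr_pdivrMr ?sqrtr_gt0 // => /ltW h.
  apply: le_trans h _.
  have -> : frob (corner_incl R n.+1) = Num.sqrt n.+1%:R.
    by rewrite -(frob_unitary (corner_incl_unitary R n.+1)) sqrtr_sqr ger0_norm ?frob_ge0.
  by have := sqrtS_le n; nra.
have := schur_intertwiner irr T'0 T'P.
by move=> /eqP rk; have := rank_leq_row T'; rewrite rk ltnn.
Qed.

End HilbertSchmidtCase.

(** * Permutations fixing a point *)

Section PermutationCorner.
Variable R : realType.

Lemma lift0_permM n : {morph @lift0_perm n : s t / (s * t)%g}.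
Proof. by move=> s t; rewrite /lift0_perm lift_permM. Qed.

Definition perm_iota n : {multiplicative sym_family R n -> sym_family R n.+1} :=
  hom_of (@lift0_permM n.+1).

Definition moved n (s t : {perm 'I_n}) := #|[pred x | s x != t x]|.

Lemma moved_lift0 n (s t : {perm 'I_n}) : moved (lift0_perm s) (lift0_perm t) = moved s t.
Proof.
have lift0E (r : {perm 'I_n}) : lift0_perm r ord0 = ord0 by exact: lift0_perm0.
have liftE (r : {perm 'I_n}) k : lift0_perm r (lift ord0 k) = lift ord0 (r k).
  exact: lift0_perm_lift.
rewrite /moved -!sum1_card big_mkcond big_ord_recl inE !lift0E eqxx /= add0n.
rewrite [RHS]big_mkcond; apply: eq_bigr => i _.
by rewrite !inE !liftE (inj_eq (lift_inj (h := ord0))).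
Qed.

Lemma perm_iota_expand n (s t : sym_family R n) :
  fam_dist s t <= 2 * fam_dist (perm_iota n s) (perm_iota n t).
Proof.
change ((moved s t)%:R / n.+1%:R <= 2 * ((moved (lift0_perm s) (lift0_perm t))%:R / n.+2%:R) :> R).
rewrite moved_lift0 mulrCA ler_wpM2l // ler_pdivlMr // mulrC ler_pdivrMr //.
by rewrite -natrM ler_nat; lia.
Qed.

Lemma perm_iota_contract n (s t : sym_family R n) :
  fam_dist (perm_iota n s) (perm_iota n t) <= fam_dist s t.
Proof.
change ((moved (lift0_perm s) (lift0_perm t))%:R / n.+2%:R <= (moved s t)%:R / n.+1%:R :> R).
by rewrite moved_lift0 ler_wpM2l // lef_pV2 ?posrE // ler_nat.
Qed.

Lemma lift0_perm_of_fix n (s : {perm 'I_n.+1}) : s ord0 = ord0 ->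
  exists t : {perm 'I_n}, s = lift0_perm t.
Proof.
move=> s0; have nz k : ord0 != s (lift ord0 k).
  by have := neq_lift ord0 k; rewrite -(inj_eq (@perm_inj _ s)) s0.
have /(_ _)/cid-/all_tag[t tP] k : exists j, s (lift ord0 k) = lift ord0 j.
  by have [j jE _] := unlift_some (nz k); exists j.
have t_inj : injective t.
  move=> i j tij; apply: (lift_inj (h := ord0)); apply: (@perm_inj _ s).
  by rewrite !tP tij.
exists (perm t_inj); apply/permP => i.
case: (unliftP ord0 i) => [k|] ->; last by rewrite s0 lift0_perm0.
by rewrite lift0_perm_lift permE tP.
Qed.

(** A transposition brings the image of the first point back to this point, and changes the
    permutation at two points at most. *)
Lemma perm_iota_dense n (s : sym_family R n.+1) :
  exists t : sym_family R n, fam_dist (perm_iota n t) s <= 2 / n.+1%:R.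
Proof.
pose s' : {perm 'I_n.+2} := s; pose r := (s' * tperm (s' ord0) ord0)%g.
have [|t tE] := @lift0_perm_of_fix _ r; first by rewrite permM tpermL.
exists t; change ((moved (lift0_perm t) s')%:R / n.+2%:R <= 2 / n.+1%:R :> R).
rewrite -tE; apply: ler_pM => //; last by rewrite lef_pV2 ?posrE // ler_nat.
rewrite ler_nat.
apply: leq_trans (_ : #|pred2 (s'^-1%g (s' ord0)) (s'^-1%g ord0)| <= 2)%N; last first.
  by rewrite card2; case: eqP.
apply/subset_leq_card/fintype.subsetP => x; rewrite !inE permM.
apply: contraNT; rewrite negb_or => /andP[x1 x2]; rewrite tpermD //.
  by apply: contraNneq x1 => ->; rewrite permK.
by apply: contraNneq x2 => ->; rewrite permK.
Qed.

Lemma harmonic2_cvg : (2 / n.+1%:R) @[n --> \oo] --> (0 : R).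
Proof. by have := cvgM (cvg_cst (2 : R)) (@cvg_harmonic R); rewrite mulr0 => h; exact: h. Qed.

(** Each row at which [s] and [t] differ contributes two entries 1 and -1. *)
Lemma frob_perm_mx n (s t : {perm 'I_n}) :
  frob (perm_mx s - perm_mx t : 'M[R[i]]_n) ^+ 2 = (moved s t).*2%:R.
Proof.
rewrite frob_sqrE /moved -sum1_card -muln2 big_distrl /= natr_sum [RHS]big_mkcond /=.
apply: eq_bigr => i _; rewrite inE.
have nat_mod (b c : bool) : sqmod (b%:R - c%:R : R[i]) = (b != c)%:R.
  by rewrite /sqmod ReD ReN ImD ImN; case: b c => [] [] /=; rewrite ?subrr; ring.
under eq_bigr => j _ do rewrite !mxE nat_mod.
case: eqVneq => [->|st].
  by rewrite big1 // => j _; rewrite eqxx.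
have ts : t i != s i by rewrite eq_sym.
rewrite (bigD1 (s i)) //= (bigD1 (t i)) //= !eqxx (negPf st) (negPf ts) /=.
rewrite big1 ?addr0 => [|j /andP[js jt]]; first by ring.
by rewrite ![_ == j]eq_sym (negPf js) (negPf jt).
Qed.

End PermutationCorner.

(** * Averages over a finite quotient *)

Section Averaging.
Variables (Gamma : groupType) (X : finType) (theta : Gamma -> X).
Hypothesis theta_l : forall g x y, theta x = theta y -> theta (g * x)%g = theta (g * y)%g.
Hypothesis theta_r : forall g x y, theta x = theta y -> theta (x * g)%g = theta (y * g)%g.

(** [theta] is the projection to a finite quotient group and [s] lists one representative for each
    element of the quotient; a translation permutes the elements of the quotient. Averages
    over a finite quotient of [Gamma] are thus expressed by elements of [Gamma]. *)
Lemma finite_quotient_sum : exists s : seq Gamma, (0 < size s)%N /\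
  forall (V : nmodType) (F : Gamma -> V), (forall x y, theta x = theta y -> F x = F y) ->
  forall g, \sum_(x <- s) F (x * g)%g = \sum_(x <- s) F x /\
            \sum_(x <- s) F (g * x)%g = \sum_(x <- s) F x.
Proof.
pose A := [seq a <- enum X | `[< exists x, theta x = a >]].
have inA x : theta x \in A by rewrite mem_filter mem_enum andbT; apply/asboolP; exists x.
have Auniq : uniq A by rewrite filter_uniq // enum_uniq.
have /choice[r rP] (a : X) : exists x, a \in A -> theta x = a.
  have [[x xa]|no] := pselect (exists x, theta x = a); first by exists x.
  by exists 1%g; rewrite mem_filter => /andP[/asboolP].
have thetar x : theta (r (theta x)) = theta x by apply: rP.
exists (map r A); split.
  by rewrite size_map; have := inA 1%g; case: (A).
move=> V F FE g.
have shift (f : Gamma -> Gamma) (f' : Gamma -> Gamma) :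
    (forall x y, theta x = theta y -> theta (f x) = theta (f y)) ->
    (forall x y, theta x = theta y -> theta (f' x) = theta (f' y)) ->
    cancel f f' -> cancel f' f ->
    \sum_(x <- map r A) F (f x) = \sum_(x <- map r A) F x.
  move=> fE f'E fK f'K; rewrite !big_map.
  rewrite [LHS](eq_bigr (fun a => F (r (theta (f (r a)))))) => [|a _].
    2: by apply: FE; rewrite thetar.
  rewrite -(big_map (fun a => theta (f (r a))) xpredT (fun a => F (r a))).
  apply: perm_big; apply: uniq_perm => //.
    rewrite map_inj_in_uniq // => a b aA bA /f'E.
    by rewrite !fK !rP.
  move=> b; apply/mapP/idP => [[a _ ->]|bA]; first exact: inA.
  exists (theta (f' (r b))) => //; rewrite -{1}(rP b bA) -{1}[r b]f'K.
  by apply: fE; rewrite thetar.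
split.
- apply: (shift (fun x => x * g)%g (fun x => x * g^-1)%g) => [x y|x y|x|x].
  + exact: theta_r.
  + exact: theta_r.
  + by rewrite mulgK.
  + by rewrite mulgKV.
- apply: (shift (fun x => g * x)%g (fun x => g^-1 * x)%g) => [x y|x y|x|x].
  + exact: theta_l.
  + exact: theta_l.
  + by rewrite mulKg.
  + by rewrite mulKVg.
Qed.

End Averaging.

(** * The permutation case *)

Section PermutationCase.
Variables (R : realType) (Gamma : groupType).
Local Notation C := R[i].

(** If the stabilizer of [i] fixed [j], then the orbit of [i] would map onto the orbit of [j],
    which has [n] points. *)
Lemma stabilizer_moves m n (phi : {multiplicative Gamma -> {perm 'I_n}})
    (psi : {multiplicative Gamma -> {perm 'I_m}}) i j :
  (m < n)%N -> transitive_action phi -> exists h, psi h i = i /\ phi h j <> j.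
Proof.
move=> mn tr; apply: contrapT => none.
have fixj h : psi h i = i -> phi h j = j.
  by move=> hi; apply: contrapT => hj; apply: none; exists h.
have [g gP] := choice (tr j).
suff : (#|'I_n| <= #|'I_m|)%N by rewrite !card_ord leqNgt mn.
apply: (@leq_card _ _ (fun k => psi (g k) i)) => a b ab.
rewrite -(gP a) -(gP b); apply: (@perm_inj _ (phi (g b))^-1%g).
rewrite permK -permM -homV -gmulfM; apply: fixj.
by rewrite gmulfM homV permM ab permK.
Qed.

Lemma perm_intertwine m n (s : {perm 'I_m}) (t : {perm 'I_n}) (T : 'M[C]_(m, n)) i j :
  ((perm_mx s)^t* *m T *m perm_mx t) i j = T (s^-1%g i) (t^-1%g j).
Proof.
rewrite tr_perm_mx map_perm_mx -row_permE -[t in LHS]invgK -col_permE.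
by rewrite !mxE.
Qed.

(** Let [i] be a point of the smaller set and [j] its copy in the larger one. The
    entry at [(i, j)] of the average of the inclusion over [Gamma] is the proportion
    of the group elements that map [(i, j)] to a pair of a point and its copy. Moving
    [(i, j)] first by an [h] that fixes [i] and moves [j] turns such elements into
    elements without this property, so the proportion is at most one half. *)
Lemma corner_defect_ge (Q : set Gamma) (kappa delta : R) n
    (phi : {multiplicative Gamma -> {perm 'I_n.+2}})
    (psi : {multiplicative Gamma -> {perm 'I_n.+1}}) :
  kazhdan_pair Q kappa -> 0 <= kappa -> 0 <= delta -> transitive_action phi ->
  (forall x, Q x -> frob (corner_incl R n.+1 *m unitary_mx (perm_rep R phi x)
     - unitary_mx (perm_rep R psi x) *m corner_incl R n.+1) <= delta) ->
  kappa ^+ 2 * n.+1%:R <= 4 * delta ^+ 2.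
Proof.
move=> kQ k0 d0 tr close.
pose theta x := (psi x, phi x).
have [||s [s0 sP]] := @finite_quotient_sum _ _ theta.
- by move=> g x y [psixy phixy]; rewrite /theta !gmulfM psixy phixy.
- by move=> g x y [psixy phixy]; rewrite /theta !gmulfM psixy phixy.
set T := corner_incl R n.+1.
have [tau tauE] := intertwiner_rep (perm_rep R psi) (perm_rep R phi).
have tau_theta x y : theta x = theta y -> unitary_mx (tau x) = unitary_mx (tau y).
  move=> [psixy phixy]; apply/row_matrixP => i; rewrite !rowE.
  by rewrite -(vec_mxK (delta_mx 0 i)) !tauE /= psixy phixy.
pose k : C := (size s)%:R; have k_neq0 : k != 0 by rewrite pnatr_eq0 -lt0n.
pose P := k^-1 *: \sum_(x <- s) unitary_mx (tau x).
have Ptau x : P *m unitary_mx (tau x) = P.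
  rewrite /P -scalemxAl mulmx_suml; congr (_ *: _).
  rewrite -[RHS](sP _ _ tau_theta x).1; apply: eq_bigr => y _.
  by rewrite gmulfM.
have tauP x : unitary_mx (tau x) *m P = P.
  rewrite /P -scalemxAr mulmx_sumr; congr (_ *: _).
  rewrite -[RHS](sP _ _ tau_theta x).2; apply: eq_bigr => y _.
  by rewrite gmulfM.
have Pid (u : 'rV[C]_(n.+1 * n.+2)) : (forall x, u *m unitary_mx (tau x) = u) -> u *m P = u.
  move=> uP; rewrite /P -scalemxAr mulmx_sumr (eq_bigr (fun=> u)) => [|x _]; last exact: uP.
  by rewrite big_const_seq count_predT iter_addr_0 -scaler_nat scalerA mulVf // scale1r.
have := kazhdan_projection kQ Ptau tauP Pid d0 (v := mxvec T).
have -> : mxvec T *m P = mxvec (k^-1 *: \sum_(x <- s)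
    ((unitary_mx (perm_rep R psi x))^t* *m T *m unitary_mx (perm_rep R phi x))).
  rewrite /P -scalemxAr mulmx_sumr [RHS]linearZ /=; congr (_ *: _); rewrite [RHS]linear_sum /=.
  by apply: eq_bigr => x _; rewrite tauE.
set U := k^-1 *: _; rewrite -linearB /= frob_mxvec => dist_le.
have {dist_le} : kappa * frob (T - U) <= delta.
  by apply: dist_le => x Qx; rewrite tauE intertwiner_displacement close.
have half i : 4^-1 <= sqmod ((T - U) i (lift ord0 i)) :> R.
  pose j := lift ord0 i.
  pose p x := phi x^-1%g j == lift ord0 (psi x^-1%g i).
  (* The term of x is the entry of T at (psi x^-1 i, phi x^-1 j) *)
  have UE : U i j = k^-1 * (\sum_(x <- s) p x)%:R.
    rewrite /U mxE summxE natr_sum; congr (_ * _); apply: eq_bigr => x _.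
    by rewrite perm_intertwine corner_inclE /p !homV.
  have [h [hi hj]] := stabilizer_moves psi i j (ltnSn n.+1) tr.
  have p_theta x y : theta x = theta y -> p x = p y :> nat.
    by move=> [psixy phixy]; rewrite /p !homV psixy phixy.
  have p_half : ((\sum_(x <- s) p x).*2 <= size s)%N.
    rewrite -addnn -{2}(sP nat p p_theta h^-1%g).1 -big_split /=.
    rewrite -[size s]sum1_size; apply: leq_sum => x _.
    rewrite /p invgM invgK !gmulfM !permM hi.
    case: eqP => // pj; case: eqP => // phj; case: hj.
    by apply: (@perm_inj _ (phi x^-1%g)); rewrite phj pj.
  have ReU : complex.Re (U i j) <= 2^-1.
    rewrite UE /k; set q := (\sum_(x <- s) p x)%N.
    have -> : (size s)%:R^-1 * q%:R = (q%:R / (size s)%:R)%:C%C :> C.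
      by rewrite rmorphM fmorphV !rmorph_nat mulrC.
    rewrite /= ler_pdivrMr ?ltr0n // mulrC ler_pdivlMr // -natrM ler_nat muln2.
    exact: p_half.
  rewrite mxE corner_inclE eqxx [X in _ + X]mxE -/j /sqmod ReD ReN /=.
  have := sqr_ge0 (complex.Im (1 - U i j)).
  nra.
have : n.+1%:R / 4 <= frob (T - U) ^+ 2.
  rewrite frob_sqrE -[n.+1 in X in X <= _]card_ord -sumr_const mulr_suml.
  apply: ler_sum => i _; rewrite mul1r (bigD1 (lift ord0 i)) //=.
  apply: le_trans (half i) _; rewrite lerDl sumr_ge0 // => l _; exact: sqmod_ge0.
have := frob_ge0 (T - U); move: (frob (T - U)) => f f0 nf kf.
have : (kappa * f) ^+ 2 <= delta ^+ 2 by rewrite ler_sqr ?nnegrE ?mulr_ge0.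
rewrite exprMn => h.
have : kappa ^+ 2 * (n.+1%:R / 4) <= kappa ^+ 2 * f ^+ 2 by rewrite ler_wpM2l ?sqr_ge0.
lra.
Qed.

Lemma perm_stable_bounded : property_T R Gamma -> stable (sym_family R) Gamma ->
  ~ (forall d, exists n (phi : {multiplicative Gamma -> {perm 'I_n}}),
    (d <= n)%N /\ transitive_action phi).
Proof.
move=> /kazhdan_pair_of_T[Q [kappa [Qfin k0 kQ]]] [S [pi [pi_surj pi_st]]] large.
(* A Hamming distance below kappa^2/32 on n+2 points gives a squared Frobenius norm
   below kappa^2 (n+2)/16, which corner_defect_ge bounds from below by kappa^2 (n+1)/4 *)
have e0 : 0 < kappa ^+ 2 / 32 by rewrite divr_gt0 ?exprn_gt0.
have [|n [phi [psi [tr close]]]] := stable_shrink (@perm_iota_expand R)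
  (@perm_iota_contract R) (@perm_iota_dense R) (@harmonic2_cvg R) pi_surj pi_st
  (P := fun n (phi : {multiplicative Gamma -> {perm 'I_n.+2}}) => transitive_action phi)
  _ Qfin e0.
  move=> d; have [[|[|n]] [phi [dn tr]]] := large d.+2 => //.
  by exists n, phi.
have [delta d0 dE] : exists2 delta : R, 0 <= delta & delta ^+ 2 = kappa ^+ 2 / 16 * n.+2%:R.
  have q0 : 0 <= kappa ^+ 2 / 16 * n.+2%:R by rewrite mulr_ge0 // divr_ge0 ?sqr_ge0.
  by exists (Num.sqrt (kappa ^+ 2 / 16 * n.+2%:R)); rewrite ?sqrtr_ge0 ?sqr_sqrtr.
have := corner_defect_ge kQ (ltW k0) d0 tr (psi := psi).
rewrite dE => defect.
have {defect} : kappa ^+ 2 * n.+1%:R <= 4 * (kappa ^+ 2 / 16 * n.+2%:R).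
  apply: defect => x Qx; apply: le_trans (frob_corner_defect _ _) _.
  rewrite -ler_sqr ?nnegrE ?frob_ge0 // dE lift0_mx_perm frob_perm_mx.
  have := close x Qx.
  change ((moved (lift0_perm (psi x)) (phi x))%:R / n.+2%:R < kappa ^+ 2 / 32 -> 
    (moved (lift0_perm (psi x)) (phi x)).*2%:R <= kappa ^+ 2 / 16 * n.+2%:R).
  rewrite ltr_pdivrMr // => /ltW.
  by rewrite -muln2 natrM; lra.
have k2 : 0 < kappa ^+ 2 by rewrite exprn_gt0.
have -> : 4 * (kappa ^+ 2 / 16 * n.+2%:R) = kappa ^+ 2 * (n.+2%:R / 4) by field.
rewrite ler_pM2l // ler_pdivlMr // -natrM ler_nat; lia.
Qed.

End PermutationCase.

(** * Finiteness of the set of finite-index subgroups *)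

Theorem theorem1p4 (R : realType) (Gamma : groupType)
    (hfg : finitely_generated Gamma)
    (hT : property_T R Gamma)
    (hstable : stable (sym_family R) Gamma \/ stable (unitary_family R) Gamma) :
  finite_set [set H : set Gamma | is_subgroup H /\ finite_index H].
Proof.
apply: contrapT => inf.
have [S [pi pi_surj]] := hfg.
have large := large_transitive_action pi_surj inf.
case: hstable => [/(perm_stable_bounded hT)|/(unitary_stable_bounded hT)]; exact.
Qed.
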